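(* Let the scalar field be $\mathbb{R}$ or $\mathbb{C}$, and let $X(\ell_2)$ be the Banach space $\{f\in C[0,1] : f|_\Delta\in E\}$, where $E\subseteq C(\Delta)$ is an isometric copy of the Hilbert space $\ell_2$ over the same field (see context). Then every non-null dissipative operator $T\in L(X(\ell_2))$ fixes a copy of $\ell_1$, whereas there are infinitely many linearly independent finite-rank dissipative operators on $X(\ell_2)^*$.
   Context: Construction of $X(E)$: let $\Delta\subset[0,1]$ be the Cantor middle third set. A separable Banach space $E$ is identified, through some fixed linear isometric embedding (which exists by the Banach–Mazur theorem), with a closed subspace of $C(\Delta)$. Then $X(E)=\{f\in C[0,1] : f|_\Delta\in E\}$, with the supremum norm. Here $E=\ell_2$. For a real or complex Banach space $Z$ with dual $Z^*$ and unit sphere $S_Z$, $L(Z)$ is the space of bounded linear operators on $Z$. The numerical range of $T\in L(Z)$ is $V(T)=\{z^*(Tz) : z\in S_Z,\ z^*\in S_{Z^*},\ z^*(z)=1\}$. An operator $T\in L(Z)$ is dissipative if $\operatorname{Re}V(T)\subset(-\infty,0]$. An operator $T\in L(Z)$ fixes a copy of $\ell_1$ if there is a closed subspace of $Z$ isomorphic to $\ell_1$ on which $T$ is an isomorphism onto its image. *)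

(* Defs.v *)
From HB Require Import structures.
From mathcomp Require Import all_boot all_order all_algebra.
From mathcomp Require Import complex.
From mathcomp Require Import all_classical all_reals all_analysis.
Import numFieldNormedType.Exports.
Import Order.TTheory GRing.Theory Num.Theory.

Set Implicit Arguments.
Unset Strict Implicit.
Unset Printing Implicit Defensive.

Local Open Scope classical_set_scope.
Local Open Scope ring_scope.

Variant scalars := RealScalars | ComplexScalars.

Definition scalar_field (R : realType) (k : scalars) : numFieldType :=
  match k with RealScalars => R | ComplexScalars => complex R end.

Definition re (R : realType) (k : scalars) : scalar_field R k -> R :=
  match k with RealScalars => fun x => x | ComplexScalars => @complex.Re R end.

Definition of_real (R : realType) (k : scalars) : R -> scalar_field R k :=
  match k with
  | RealScalars => fun x => x
  | ComplexScalars => @real_complex R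
  end.

Section scalar_theory.
Context {R : realType} {k : scalars}.
Local Notation K := (scalar_field R k).
Local Notation re := (@re R k).
Local Notation of_real := (@of_real R k).

(* Norms on a [normedModType K] are [K]-valued; this is the [R]-valued one. *)
Definition absR (z : K) : R := re `|z|.

Lemma of_realK : cancel of_real re.
Proof. by rewrite /of_real /re; case: k. Qed.

Lemma of_realD x y : of_real (x + y) = of_real x + of_real y.
Proof. by rewrite /of_real; case: k => //=; rewrite rmorphD. Qed.

Lemma of_realM x y : of_real (x * y) = of_real x * of_real y.
Proof. by rewrite /of_real; case: k => //=; rewrite rmorphM. Qed.

Lemma of_real0 : of_real 0 = 0.
Proof. by rewrite /of_real; case: k. Qed.

Lemma ler_of_real x y : (of_real x <= of_real y) = (x <= y).
Proof. by rewrite /of_real; case: k => //=; rewrite lecR. Qed.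

Lemma ltr_of_real x y : (of_real x < of_real y) = (x < y).
Proof. by rewrite !lt_neqAle ler_of_real (can_eq of_realK). Qed.

Lemma ler_re z w : z <= w -> re z <= re w.
Proof.
by move: z w; rewrite /re; case: k => //= z w; rewrite lecE => /andP[].
Qed.

Lemma absRK z : of_real (absR z) = `|z|.
Proof. by rewrite /absR; move: z; rewrite /of_real /re; case: k. Qed.

Lemma absR_ge0 z : 0 <= absR z.
Proof. by rewrite -ler_of_real absRK of_real0. Qed.

Lemma absRD x y : absR (x + y) <= absR x + absR y.
Proof. by rewrite -ler_of_real of_realD !absRK ler_normD. Qed.

Lemma absRM x y : absR (x * y) = absR x * absR y.
Proof. by apply: (can_inj of_realK); rewrite of_realM !absRK normrM. Qed.

Lemma absR0 : absR 0 = 0.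
Proof. by apply: (can_inj of_realK); rewrite absRK normr0 of_real0. Qed.

Lemma absR_eq0 z : absR z = 0 -> z = 0.
Proof. by move=> z0; apply: normr0_eq0; rewrite -absRK z0 of_real0. Qed.

Lemma absR_continuous : continuous (absR : K^o -> R^o).
Proof.
move=> x; apply/(@cvgrPdist_lt _ R^o _ (nbhs x) (nbhs_filter x)) => e e0.
have e'0 : 0 < of_real e by rewrite -of_real0 ltr_of_real.
have := @cvgr_dist_lt _ K^o _ _ (nbhs_filter x) id x cvg_id _ e'0.
apply: filterS => y /= xy; rewrite -[ltRHS]of_realK.
have : absR (x - y) < e by rewrite -ltr_of_real absRK.
rewrite of_realK; apply: le_lt_trans.
have xy' : absR (x - y) = absR (y - x) by rewrite /absR distrC.
rewrite ler_norml lerNl opprB !lerBlDr {1}xy'.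
by rewrite !(le_trans _ (absRD _ _))// subrK.
Qed.

End scalar_theory.

Section sup_norm.
Context {R : realType} {k : scalars} {T : Type}.
Local Notation K := (scalar_field R k).
Implicit Types (A : set T) (f g : T -> K^o).

(* Meaningful only when f is bounded on A: [sup] is 0 on unbounded sets. *)
Definition sup_norm A f : K := of_real k (sup [set absR (f x) | x in A]).

Definition bounded_fct A f := has_ubound [set absR (f x) | x in A].

Lemma sup_ub A f x : bounded_fct A f -> A x ->
  absR (f x) <= sup [set absR (f x) | x in A].
Proof. by move=> bf Ax; apply: ub_le_sup => //; exists x. Qed.

Lemma sup_le A f r : 0 <= r -> (forall x, A x -> absR (f x) <= r) ->
  sup [set absR (f x) | x in A] <= r.
Proof.
move=> r0 fr; have [->|/set0P[x Ax]] := eqVneq A set0.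
  by rewrite image_set0 sup0.
apply: ge_sup; first by exists (absR (f x)), x.
by move=> _ [y Ay <-]; exact: fr.
Qed.

Lemma sup_ge0 A f : 0 <= sup [set absR (f x) | x in A].
Proof.
have [[[_ [x Ax _]] b]|/sup_out->//] :=
  pselect (has_sup [set absR (f x) | x in A]).
exact: le_trans (absR_ge0 _) (sup_ub b Ax).
Qed.

Lemma sup_normD A f g : bounded_fct A f -> bounded_fct A g ->
  sup_norm A (f + g) <= sup_norm A f + sup_norm A g.
Proof.
move=> bf bg; rewrite /sup_norm -of_realD ler_of_real.
apply: sup_le => [|x Ax]; first by rewrite addr_ge0 ?sup_ge0.
by rewrite (le_trans (absRD _ _))// lerD// sup_ub.
Qed.

Lemma bounded_fctZ A l f : bounded_fct A f -> bounded_fct A (l *: f).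
Proof.
move=> bf; exists (absR l * sup [set absR (f x) | x in A]) => _ [x Ax <-].
by rewrite absRM ler_wpM2l ?absR_ge0 ?sup_ub.
Qed.

Let sup_normZ_le A l f : bounded_fct A f ->
  sup_norm A (l *: f) <= `|l| * sup_norm A f.
Proof.
move=> bf; rewrite -(absRK l) /sup_norm -of_realM ler_of_real.
apply: sup_le => [|x Ax]; first by rewrite mulr_ge0 ?absR_ge0 ?sup_ge0.
by rewrite absRM ler_wpM2l ?absR_ge0 ?sup_ub.
Qed.

Lemma sup_normZ A l f : bounded_fct A f ->
  sup_norm A (l *: f) = `|l| * sup_norm A f.
Proof.
move=> bf; apply/eqP; rewrite eq_le sup_normZ_le//=.
have [->|l0] := eqVneq l 0.
  by rewrite normr0 mul0r -(of_real0 (k := k)) ler_of_real sup_ge0.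
rewrite -ler_pdivlMl ?normr_gt0// -normfV.
by rewrite -{1}[f](scalerK l0) sup_normZ_le//; exact: bounded_fctZ.
Qed.

Lemma sup_norm0_eq0 A f x : bounded_fct A f -> sup_norm A f = 0 -> A x ->
  f x = 0.
Proof.
move=> bf s0 Ax; have {}s0 : sup [set absR (f x) | x in A] = 0.
  by apply: (can_inj (@of_realK R k)); rewrite of_real0.
apply: (@absR_eq0 R k (f x)); apply/eqP.
by rewrite eq_le absR_ge0 -s0 sup_ub.
Qed.

End sup_norm.

Section ell.
Context {R : realType} {k : scalars} {p : R}.
Local Notation K := (scalar_field R k).

Definition ell_sum (x : nat -> K^o) : \bar R :=
  (\sum_(0 <= n <oo) (absR (x n) `^ p)%:E)%E.

Definition summable_pow : {pred nat -> K^o} :=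
  mem [set x | (ell_sum x < +oo)%E].

Record ell (p1 : 1 <= p) := Ell {
  ell_fun :> nat -> K^o;
  ell_funP : ell_fun \in summable_pow }.

Context {p1 : 1 <= p}.

Let p0 : 0 < p. Proof. exact: lt_le_trans p1. Qed.

Let N (x : nat -> K^o) := ('N[counting]_p%:E [EFin \o (@absR R k \o x)])%E.

Let NE x : N x = (ell_sum x `^ p^-1)%E.
Proof.
rewrite /N Lnorm_counting//; congr (_ `^ _)%E.
by apply: eq_eseriesr => n _ /=; rewrite ger0_norm ?absR_ge0.
Qed.

Let ell_sum_ge0 x : (0 <= ell_sum x)%E.
Proof. by apply: nneseries_ge0 => n _ _; rewrite lee_fin powR_ge0. Qed.

Let ell_sum_lty x : (ell_sum x < +oo)%E = (N x < +oo)%E.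
Proof.
rewrite NE; apply/idP/idP => [|h]; first exact: poweR_lty.
by apply: (@lty_poweRy _ _ p^-1) => //; rewrite gt_eqF ?invr_gt0.
Qed.

Let ND (x y : nat -> K^o) : (N (x + y)%R <= N x + N y)%E.
Proof.
apply: le_trans (minkowski_EFin _ _ _ _) => //.
rewrite /N !Lnorm_counting//; apply: gt0_ler_poweR.
- by rewrite invr_ge0 ltW.
- by rewrite in_itv/= leey andbT nneseries_ge0// => n _ _; rewrite poweR_ge0.
- by rewrite in_itv/= leey andbT nneseries_ge0// => n _ _; rewrite poweR_ge0.
apply: lee_nneseries => n _; first by move=> _; rewrite poweR_ge0.
rewrite /= lee_fin ge0_ler_powR ?nnegrE ?normr_ge0 ?(ltW p0)//.
by rewrite !ger0_norm ?addr_ge0 ?absR_ge0// absRD.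
Qed.

Let ell_sumZ (l : K) (x : nat -> K^o) :
  ell_sum (l *: x)%R = ((absR l `^ p)%:E * ell_sum x)%E.
Proof.
rewrite /ell_sum -nneseriesZl//; last by move=> n _; rewrite lee_fin powR_ge0.
by apply: eq_eseriesr => n _; rewrite -EFinM -powRM ?absR_ge0// -absRM.
Qed.

Fact summable_pow_closed : submod_closed summable_pow.
Proof.
split=> [|l x y]; rewrite !inE/=.
  rewrite /ell_sum eseries0// => n _ _.
  by rewrite absR0 powR0// gt_eqF.
move=> xy yy; rewrite ell_sum_lty (le_lt_trans (ND _ _))// lte_add_pinfty//.
  by rewrite -ell_sum_lty ell_sumZ lte_mul_pinfty// lee_fin powR_ge0.
by rewrite -ell_sum_lty.
Qed.

HB.instance Definition _ :=
  GRing.isSubmodClosed.Build _ _ summable_pow summable_pow_closed.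
HB.instance Definition _ := [isSub for @ell_fun p1].
HB.instance Definition _ := [Choice of ell p1 by <:].
HB.instance Definition _ := [SubChoice_isSubLmodule of ell p1 by <:].

Definition ell_norm (x : ell p1) : K :=
  of_real k (fine (ell_sum x) `^ p^-1).

Let ell_norm_lnorm (x : ell p1) : ((fine (ell_sum x) `^ p^-1)%:E = N x)%E.
Proof.
have := ell_funP x; rewrite inE/= => xy.
by rewrite NE -poweR_EFin fineK// ge0_fin_numE.
Qed.

Let ell_normD (x y : ell p1) : ell_norm (x + y) <= ell_norm x + ell_norm y.
Proof.
rewrite /ell_norm -of_realD ler_of_real -lee_fin EFinD.
have := ND x y; rewrite -(ell_norm_lnorm x) -(ell_norm_lnorm y).
apply: le_trans.
by have -> := ell_norm_lnorm (x + y).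
Qed.

Let ell_normZ l (x : ell p1) : ell_norm (l *: x) = `|l| * ell_norm x.
Proof.
rewrite /ell_norm -(absRK l) -of_realM; congr (of_real _ _).
have -> : ell_sum (l *: x) = ((absR l `^ p)%:E * ell_sum x)%E.
  exact: ell_sumZ.
rewrite fineM//=; last first.
  by have := ell_funP x; rewrite inE/= => xy; rewrite ge0_fin_numE.
rewrite powRM ?powR_ge0 ?fine_ge0// -powRrM mulfV ?gt_eqF//.
by rewrite powRr1 ?absR_ge0.
Qed.

Let ell_norm0_eq0 (x : ell p1) : ell_norm x = 0 -> x = 0.
Proof.
move=> x0; have {}x0 : fine (ell_sum x) `^ p^-1 = 0.
  by apply: (can_inj (@of_realK R k)); rewrite of_real0.
apply/val_inj/funext => n /=; apply: (@absR_eq0 R k (x n)).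
apply: (@powR_eq0_eq0 _ _ p); apply/eqP; rewrite eq_le powR_ge0 andbT.
have := ell_funP x; rewrite inE/= => xy.
have <- : fine (ell_sum x) = 0 by exact: powR_eq0_eq0 x0.
rewrite -lee_fin fineK ?ge0_fin_numE//.
apply: le_trans (nneseries_lim_ge n.+1 _); last first.
  by move=> m _ _; rewrite lee_fin powR_ge0.
rewrite big_nat_recr//= leeDr// sume_ge0// => m _.
by rewrite lee_fin powR_ge0.
Qed.

HB.instance Definition _ :=
  Lmodule_isNormed.Build K (ell p1) ell_normD ell_normZ ell_norm0_eq0.

End ell.

Arguments ell R k {p} p1.

Definition ell1 (R : realType) (k : scalars) := ell R k (lexx (1 : R)).
Definition ell2 (R : realType) (k : scalars) := ell R k (ler1n R 2).

HB.instance Definition _ R k := NormedModule.on (@ell1 R k).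
HB.instance Definition _ R k := NormedModule.on (@ell2 R k).

Section continuous_functions.
Context {R : realType} {k : scalars} {T : topologicalType}.
Local Notation K := (scalar_field R k).

Definition continuous_fct : {pred T -> K^o} :=
  mem [set f : T -> K^o | continuous f].

(* The index cT is what makes the sup norm finite. *)
Record cspace (cT : compact [set: T]) := CSpace {
  cspace_fun :> T -> K^o;
  cspace_funP : cspace_fun \in continuous_fct }.

Context {cT : compact [set: T]}.

Fact continuous_fct_closed : submod_closed continuous_fct.
Proof.
split=> [|l f g]; rewrite !inE/=; first by move=> x; exact: cvg_cst.
move=> cf cg x; apply: cvgD; last exact: cg.
by apply: cvgZr; exact: cf.
Qed.

HB.instance Definition _ :=
  GRing.isSubmodClosed.Build _ _ continuous_fct continuous_fct_closed.
HB.instance Definition _ := [isSub for @cspace_fun cT].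
HB.instance Definition _ := [Choice of cspace cT by <:].
HB.instance Definition _ := [SubChoice_isSubLmodule of cspace cT by <:].

Let cspace_bounded (f : cspace cT) : bounded_fct [set: T] f.
Proof.
have := cspace_funP f; rewrite inE/= => cf.
have /compact_bounded : compact ((@absR R k \o f : T -> R^o) @` [set: T]).
  apply: continuous_compact => //; apply: continuous_subspaceT => x.
  by apply: continuous_comp; [exact: cf|exact: absR_continuous].
move=> /pinfty_ex_gt0[M _ fM]; exists M => _ [x _ <-].
by apply: le_trans (fM (absR (f x)) _); [exact: ler_norm|exists x].
Qed.

Definition cspace_norm (f : cspace cT) : K := sup_norm [set: T] f.

Let cspace_normD f g : cspace_norm (f + g) <= cspace_norm f + cspace_norm g.
Proof. exact: (sup_normD (cspace_bounded f) (cspace_bounded g)). Qed.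

Let cspace_normZ l f : cspace_norm (l *: f) = `|l| * cspace_norm f.
Proof. exact: (sup_normZ l (cspace_bounded f)). Qed.

Let cspace_norm0_eq0 f : cspace_norm f = 0 -> f = 0.
Proof.
move=> f0; apply/val_inj/funext => x.
exact: (sup_norm0_eq0 (cspace_bounded f) f0).
Qed.

HB.instance Definition _ := Lmodule_isNormed.Build K (cspace cT)
  cspace_normD cspace_normZ cspace_norm0_eq0.

End continuous_functions.

Lemma compact_set_type (T : topologicalType) (A : set T) :
  compact A -> compact [set: A].
Proof.
move=> cA F FF _.
have GA : (set_val @ F) A.
  by rewrite nbhs_simpl/=; apply: filterE => x; exact: set_valP.
have [x [Ax clx]] := cA _ _ GA.
pose xA : A := exist _ x (mem_set Ax); exists xA; split => // B U FB /= nU.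
move: nU => [_ [/= [V oV <-] Vx] VU].
have FB' : (set_val @ F) (set_val @` B).
  by rewrite nbhs_simpl/=; apply: filterS FB => b Bb; exists b.
have [y [[b Bb <-] Vb]] := clx _ V FB' (open_nbhs_nbhs (conj oV Vx)).
by exists b; split=> //; exact: VU.
Qed.

Section cantor_set.
Context {R : realType}.

Fixpoint cantor_stage (n : nat) : set R :=
  if n is m.+1 then
    [set x / 3 | x in cantor_stage m] `|`
    [set (x + 2) / 3 | x in cantor_stage m]
  else `[0, 1].

Definition cantor_middle_third : set R := \bigcap_n cantor_stage n.

Lemma cantor_stageS n : cantor_stage n.+1 =
  (fun x => 3 * x) @^-1` cantor_stage n `|`
  (fun x => 3 * x - 2) @^-1` cantor_stage n.
Proof.
apply/seteqP; split=> x /= [].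
- by move=> [y Cy <-]; left; rewrite mulrC divfK.
- by move=> [y Cy <-]; right; rewrite mulrC divfK// addrK.
- by move=> Cx; left; exists (3 * x) => //; rewrite mulrC mulKf.
- by move=> Cx; right; exists (3 * x - 2) => //; rewrite subrK mulrC mulKf.
Qed.

Lemma closed_cantor_stage n : closed (cantor_stage n).
Proof.
elim: n => [|n IH]; first exact: interval_closed.
rewrite cantor_stageS; apply: closedU; apply: preimage_closed => // x _.
- by apply: cvgMr; exact: cvg_id.
- by apply: cvgB; [apply: cvgMr; exact: cvg_id|exact: cvg_cst].
Qed.

Lemma cantor_sub_unit : cantor_middle_third `<=` `[0, 1].
Proof. by move=> x /(_ 0%N I). Qed.

Lemma compact_unit : compact (`[0, 1] : set R).
Proof. exact: segment_compact. Qed.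

Lemma compact_cantor : compact cantor_middle_third.
Proof.
rewrite -(setIidr cantor_sub_unit); apply: compact_closedI.
  exact: compact_unit.
by apply: closed_bigI => n _; exact: closed_cantor_stage.
Qed.

Definition cantor_incl (x : cantor_middle_third) : `[0, 1]%classic : set R :=
  SigSub (mem_set (cantor_sub_unit (set_valP x))).

End cantor_set.

Definition C01 (R : realType) (k : scalars) :=
  @cspace R k _ (compact_set_type (@compact_unit R)).

Definition C_cantor (R : realType) (k : scalars) :=
  @cspace R k _ (compact_set_type (@compact_cantor R)).

HB.instance Definition _ R k := NormedModule.on (@C01 R k).
HB.instance Definition _ R k := NormedModule.on (@C_cantor R k).

(* [X_space J] is X(E) for E the range of the embedding J : V -> C(Delta). *)
Section X_space.
Context {R : realType} {k : scalars}.
Local Notation K := (scalar_field R k).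
Context {V : normedModType K}.
Implicit Type J : {linear V -> C_cantor R k}.

Definition X_pred J : {pred C01 R k} :=
  mem [set f : C01 R k | exists v, f \o cantor_incl = J v].

Record X_space J := XSpace {
  X_fun :> C01 R k;
  X_funP : X_fun \in X_pred J }.

Context {J : {linear V -> C_cantor R k}}.

Fact X_pred_closed : submod_closed (X_pred J).
Proof.
split=> [|l f g]; rewrite !inE/=; first by exists 0; rewrite linear0.
by move=> [v fv] [w gw]; exists (l *: v + w); rewrite linearP/= -fv -gw.
Qed.

HB.instance Definition _ :=
  GRing.isSubmodClosed.Build _ _ (X_pred J) X_pred_closed.
HB.instance Definition _ := [isSub for @X_fun J].
HB.instance Definition _ := [Choice of X_space J by <:].
HB.instance Definition _ := [SubChoice_isSubLmodule of X_space J by <:].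

Definition X_norm (f : X_space J) : K := `|X_fun f|.

Let X_normD f g : X_norm (f + g) <= X_norm f + X_norm g.
Proof. exact: ler_normD. Qed.

Let X_normZ l f : X_norm (l *: f) = `|l| * X_norm f.
Proof. exact: normrZ. Qed.

Let X_norm0_eq0 f : X_norm f = 0 -> f = 0.
Proof. by move=> /normr0_eq0 f0; exact: val_inj. Qed.

HB.instance Definition _ :=
  Lmodule_isNormed.Build K (X_space J) X_normD X_normZ X_norm0_eq0.

End X_space.

Section dual.
Context {R : realType} {k : scalars}.
Local Notation K := (scalar_field R k).
Context {Z : normedModType K}.

Definition dual_pred : {pred Z -> K^o} :=
  mem [set phi : Z -> K^o | linear phi /\ continuous phi].

Record dual := Dual {
  dual_fun :> Z -> K^o;
  dual_funP : dual_fun \in dual_pred }.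

Fact dual_pred_closed : submod_closed dual_pred.
Proof.
split=> [|l f g]; rewrite !inE/=.
  split; last by move=> x; exact: cvg_cst.
  by move=> a u v; rewrite scaler0 addr0.
move=> [lf cf] [lg cg]; split=> [a u v|x].
  by rewrite !fctE lf lg !scalerDr !scalerA addrACA (mulrC l).
by apply: cvgD; [apply: cvgZr; exact: cf|exact: cg].
Qed.

HB.instance Definition _ :=
  GRing.isSubmodClosed.Build _ _ dual_pred dual_pred_closed.
HB.instance Definition _ := [isSub for dual_fun].
HB.instance Definition _ := [Choice of dual by <:].
HB.instance Definition _ := [SubChoice_isSubLmodule of dual by <:].

Fact dual_is_linear (phi : dual) : linear phi.
Proof. by have := dual_funP phi; rewrite inE/= => -[]. Qed.

HB.instance Definition _ (phi : dual) :=
  GRing.isLinear.Build K Z K^o _ (dual_fun phi) (dual_is_linear phi).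

Fact dual_continuous (phi : dual) : continuous phi.
Proof. by have := dual_funP phi; rewrite inE/= => -[]. Qed.

Let unit_ball : set Z := [set z | `|z| <= 1].

Let dual_bounded (phi : dual) : bounded_fct unit_ball phi.
Proof.
have /linear_bounded_continuous/linear_boundedP := @dual_continuous phi.
move=> /pinfty_ex_gt0[M M0 phiM]; exists (re M) => _ [z z1 <-].
apply: ler_re; apply: le_trans (phiM z) _.
by rewrite ler_piMr// ltW.
Qed.

Definition dual_norm (phi : dual) : K := sup_norm [set z | `|z| <= 1] phi.

Let dual_normD f g : dual_norm (f + g) <= dual_norm f + dual_norm g.
Proof. exact: (sup_normD (dual_bounded f) (dual_bounded g)). Qed.

Let dual_normZ l f : dual_norm (l *: f) = `|l| * dual_norm f.
Proof. exact: (sup_normZ l (dual_bounded f)). Qed.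

Let dual_norm0_eq0 f : dual_norm f = 0 -> f = 0.
Proof.
move=> f0; apply/val_inj/funext => z /=.
have [->|z0] := eqVneq z 0; first exact: linear0.
have /(sup_norm0_eq0 (dual_bounded f) f0) : unit_ball (`|z|^-1 *: z).
  by rewrite /unit_ball/= normrZ normfV normr_id mulVf// normr_eq0.
move=> /eqP; rewrite linearZ/= scaler_eq0 invr_eq0 normr_eq0 (negbTE z0)/=.
by move/eqP.
Qed.

HB.instance Definition _ :=
  Lmodule_isNormed.Build K dual dual_normD dual_normZ dual_norm0_eq0.

End dual.
Arguments dual {R k} Z.

Section operators.
Context {R : realType} {k : scalars}.
Local Notation K := (scalar_field R k).

Definition numerical_range (Z : normedModType K) (T : Z -> Z) : set K :=
  [set a | exists (z : Z) (phi : dual Z),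
     [/\ `|z| = 1, `|phi| = 1, phi z = 1 & a = phi (T z)]].

Definition dissipative (Z : normedModType K) (T : Z -> Z) : Prop :=
  forall a, numerical_range T a -> re a <= 0.

Definition finite_rank (Z : normedModType K) (T : Z -> Z) : Prop :=
  exists n (v : 'I_n -> Z), forall z, exists a : 'I_n -> K,
    T z = \sum_(i < n) a i *: v i.

Definition linearly_independent (V : lmodType K) (v : nat -> V) : Prop :=
  forall n (a : 'I_n -> K),
    \sum_(i < n) a i *: v i = 0 -> forall i, a i = 0.

(* f restricts to a homeomorphism from A onto f(A); for f linear and A a
   subspace, this is an isomorphism of A onto f(A). *)
Definition iso_onto_image (V W : normedModType K) (A : set V) (f : V -> W) :=
  {within A, continuous f} /\
  exists2 g : W -> V, {in A, cancel f g} & {within f @` A, continuous g}.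

Definition fixes_copy_of_ell1 (Z : normedModType K) (T : Z -> Z) : Prop :=
  exists (Y : set Z) (U : {linear ell1 R k -> Z}),
    [/\ closed Y, submod_closed [in Y],
        range U = Y, iso_onto_image [set: ell1 R k] U & iso_onto_image Y T].

End operators.

(* Main.v *)
(* Let |g| <= 1 and (Tg)(t) = delta > 0 for a dissipative T.  If g is changed on a
   short interval off the Cantor set into a function F with |F| = 1 and F(s) = u,
   |u| = 1, for some s in that interval, then Re ((TF)(s) / u) <= 0.  Conversely,
   series of bumps are weakly unconditionally Cauchy, so narrow perturbations
   leave TF almost equal to Tg at finitely many prescribed points.  Repeating
   both moves inside all the open sets obtained so far yields functions F_n such
   that, independently for each n, one can choose between (TF_n)(t) being close
   to delta and Re (w (TF_n)(t)) being almost nonpositive, for w in a finite net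
   of the unit circle.  Hence (T F_n) is equivalent to the basis of l1, as in
   Rosenthal's criterion.  All F_n agree with g on the Cantor set, so l1 sums of the F_n stay
   in X(E), whatever E is.

   On the dual, let f_n^* be the functional giving the n-th l2 coordinate of the
   restriction to the Cantor set, and lam_n x^* the limit of x^* along extensions
   of J e_n localized near the Cantor set.  Then Id - lam_n (.) f_n^* is a
   contraction, because these extensions can be subtracted from f near the
   Cantor set without increasing its norm in the limit, and an operator S with
   |Id + S| <= 1 is dissipative. *)

Require Import Defs.
From HB Require Import structures.
From mathcomp Require Import all_boot all_order all_algebra.
From mathcomp Require Import complex.
From mathcomp Require Import all_classical all_reals all_analysis.
From mathcomp Require Import ring lra.
Import numFieldNormedType.Exports.
Import Order.TTheory GRing.Theory Num.Theory.

Set Implicit Arguments.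
Unset Strict Implicit.
Unset Printing Implicit Defensive.

Local Open Scope classical_set_scope.
Local Open Scope ring_scope.

(** * Scalars and real-valued norms *)

Lemma sum_ordB (V : zmodType) (f : nat -> V) (n m : nat) : (n <= m)%N ->
  \sum_(i < m) f i - \sum_(i < n) f i = \sum_(n <= i < m) f i.
Proof.
move=> nm; rewrite -!(big_mkord xpredT f) (big_cat_nat (leq0n n) nm)/=.
by rewrite addrAC subrr add0r.
Qed.

Lemma nonneg_series_is_cvg (R : realType) (a : nat -> R) (C : R) :
  (forall n, 0 <= a n) -> (forall n, \sum_(i < n) a i <= C) ->
  cvgn (fun n => \sum_(i < n) a i : R^o).
Proof.
move=> a0 aC; apply: nondecreasing_is_cvgn.
  by apply/nondecreasing_seqP => n; rewrite big_ord_recr/= lerDl.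
by exists C => _ [n _ <-]; exact: aC.
Qed.

Section scalars.
Context {R : realType} {k : scalars}.
Local Notation K := (scalar_field R k).
Local Notation re := (@re R k).
Local Notation of_real := (@of_real R k).

Definition im : K -> R :=
  match k with RealScalars => fun=> 0 | ComplexScalars => @complex.Im R end.

(* Zero over the reals, so that [re_im] holds for both scalar fields. *)
Definition imag_unit : K :=
  match k with RealScalars => 0 | ComplexScalars => Complex 0 1 end.

Lemma re_im z : z = of_real (re z) + imag_unit * of_real (im z).
Proof.
rewrite /re /of_real /im /imag_unit; move: z; case: k => /= z.
  by rewrite mul0r addr0.
by case: z => a b /=; rewrite /real_complex_def; simpc.
Qed.

Lemma of_real1 : of_real 1 = 1.
Proof. by rewrite /of_real; case: k. Qed.

Lemma of_realN x : of_real (- x) = - of_real x.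
Proof. by apply/eqP; rewrite -subr_eq0 opprK -of_realD addNr of_real0. Qed.

Lemma reD z w : re (z + w) = re z + re w.
Proof. by rewrite /re; move: z w; case: k => //= z w; rewrite raddfD. Qed.

Lemma imD z w : im (z + w) = im z + im w.
Proof. by rewrite /im; move: z w; case: k => //= z w; rewrite ?raddfD ?addr0. Qed.

Lemma reMl x z : re (of_real x * z) = x * re z.
Proof.
rewrite /re /of_real; move: z; case: k => //= -[a b] /=.
by rewrite mul0r subr0.
Qed.

Lemma reN z : re (- z) = - re z.
Proof. by rewrite /re; move: z; case: k => //= z; rewrite raddfN. Qed.

Lemma imN z : im (- z) = - im z.
Proof. by rewrite /im; move: z; case: k => //= z; rewrite ?raddfN ?oppr0. Qed.

Lemma reB z w : re (z - w) = re z - re w. Proof. by rewrite reD reN. Qed.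

Lemma imB z w : im (z - w) = im z - im w. Proof. by rewrite imD imN. Qed.

Lemma re0 : re 0 = 0. Proof. by rewrite -[0 in LHS](of_real0 (k := k)) of_realK. Qed.

Lemma re_sum n (z : 'I_n -> K) : re (\sum_(i < n) z i) = \sum_(i < n) re (z i).
Proof. by apply: (big_morph _ reD re0). Qed.

Lemma absR_of_real x : absR (of_real x) = `|x|.
Proof.
apply: (can_inj (@of_realK R k)); rewrite absRK /of_real; case: k => //=.
by rewrite normc_def /= expr0n/= addr0 sqrtr_sqr.
Qed.

Lemma re_norm_le z : `|re z| <= absR z.
Proof.
rewrite -(@ler_of_real R k) absRK /re /of_real; move: z; case: k => //= z.
by apply: normc_ge_Re.
Qed.

Lemma im_norm_le z : `|im z| <= absR z.
Proof.
rewrite -(@ler_of_real R k) absRK /im /of_real; move: z; case: k => /= [z|z].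
  by rewrite normr0.
by case: z => a b /=; rewrite normc_def lecR -sqrtr_sqr ler_wsqrtr ?lerDr ?sqr_ge0.
Qed.

Lemma re_le z : re z <= absR z.
Proof. exact: le_trans (ler_norm _) (re_norm_le _). Qed.

Lemma absR_imag_unit : absR (imag_unit : K) <= 1.
Proof.
rewrite -(@ler_of_real R k) absRK /imag_unit /of_real; case: k => /=.
  by rewrite normr0.
by rewrite normc_def /= expr0n expr1n /= add0r sqrtr1.
Qed.

Lemma absR1 : absR (1 : K) = 1.
Proof. by apply: (can_inj (@of_realK R k)); rewrite absRK normr1 /of_real; case: k. Qed.

Lemma absRN (z : K) : absR (- z) = absR z.
Proof. by rewrite /absR normrN. Qed.

Lemma absRB (z w : K) : absR (z - w) = absR (w - z).
Proof. by rewrite /absR distrC. Qed.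

Lemma absRV (z : K) : absR z^-1 = (absR z)^-1.
Proof.
have [->|z0] := eqVneq z 0; first by rewrite invr0 absR0 invr0.
have az0 : absR z != 0 by apply: contra_neq z0; exact: absR_eq0.
by apply: (mulfI az0); rewrite mulfV// -absRM mulfV// absR1.
Qed.

Lemma absR_gt0 (z : K) : (0 < absR z) = (z != 0).
Proof.
rewrite lt_neqAle absR_ge0 andbT eq_sym; apply/idP/idP; apply: contra_neq.
  by move->; rewrite absR0.
exact: absR_eq0.
Qed.

Lemma absR_sum (I : Type) (r : seq I) (P : pred I) (z : I -> K) :
  absR (\sum_(i <- r | P i) z i) <= \sum_(i <- r | P i) absR (z i).
Proof.
elim/big_ind2 : _ => [|x y x' y' h h'|//]; first by rewrite absR0.
by rewrite (le_trans (absRD _ _))// lerD.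
Qed.

Lemma ge0_of_real_re (e : K) : 0 <= e -> of_real (re e) = e.
Proof. by move=> e0; have := absRK e; rewrite /absR ger0_norm. Qed.

(** The norm of a [normedModType K] is [K]-valued; suprema and linear arithmetic are handled with
    this [R]-valued copy. *)
Definition nrm (V : normedModType K) (x : V) : R := re `|x|.

Lemma of_real_nrm (V : normedModType K) (x : V) : of_real (nrm x) = `|x|.
Proof. by rewrite /nrm ge0_of_real_re. Qed.

Lemma nrm_ge0 (V : normedModType K) (x : V) : 0 <= nrm x.
Proof. by rewrite -(@ler_of_real R k) of_real_nrm of_real0. Qed.

Lemma nrmD (V : normedModType K) (x y : V) : nrm (x + y) <= nrm x + nrm y.
Proof. by rewrite -(@ler_of_real R k) of_realD !of_real_nrm ler_normD. Qed.

Lemma nrmN (V : normedModType K) (x : V) : nrm (- x) = nrm x.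
Proof. by rewrite /nrm normrN. Qed.

Lemma nrmZ (V : normedModType K) (a : K) (x : V) : nrm (a *: x) = absR a * nrm x.
Proof.
apply: (can_inj (@of_realK R k)).
by rewrite of_realM absRK !of_real_nrm normrZ.
Qed.

Lemma nrm0 (V : normedModType K) : nrm (0 : V) = 0.
Proof. by rewrite /nrm normr0 re0. Qed.

Lemma nrm_eq0 (V : normedModType K) (x : V) : nrm x = 0 -> x = 0.
Proof. by move=> x0; apply: normr0_eq0; rewrite -of_real_nrm x0 of_real0. Qed.

Lemma nrm1P (V : normedModType K) (x : V) : `|x| = 1 <-> nrm x = 1.
Proof.
split=> [x1|x1]; first by rewrite /nrm x1 -of_real1 of_realK.
by rewrite -of_real_nrm x1 of_real1.
Qed.

Lemma nrm_le1P (V : normedModType K) (x : V) : (`|x| <= 1) = (nrm x <= 1).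
Proof. by rewrite -of_real_nrm -of_real1 ler_of_real. Qed.

Lemma cvg_nrmP (V : normedModType K) (T : Type) (F : set_system T)
    (FF : Filter F) (f : T -> V) (l : V) :
  f @ F --> l <-> forall e : R, 0 < e -> \forall x \near F, nrm (l - f x) < e.
Proof.
split=> [fl e e0|fl].
  have e'0 : 0 < of_real e by rewrite -(@of_real0 R k) ltr_of_real.
  have := @cvgr_dist_lt _ V _ _ FF f l fl _ e'0.
  by apply: filterS => x; rewrite -of_real_nrm ltr_of_real.
apply/(@cvgrPdist_lt _ V) => e e0.
have eE : of_real (re e) = e by rewrite ge0_of_real_re// ltW.
have e'0 : 0 < re e by rewrite -(@ltr_of_real R k) of_real0 eE.
by apply: filterS (fl _ e'0) => x; rewrite -(@ltr_of_real R k) of_real_nrm eE.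
Qed.

Lemma cvg_absRP (T : Type) (F : set_system T) (FF : Filter F) (f : T -> K^o) (l : K) :
  f @ F --> (l : K^o) <-> forall e : R, 0 < e -> \forall x \near F, absR (l - f x) < e.
Proof. exact: (@cvg_nrmP K^o). Qed.

Lemma of_real_continuous : continuous (of_real : R^o -> K^o).
Proof.
move=> x; apply/cvg_absRP => e e0.
have := @cvgr_dist_lt _ R^o _ _ (nbhs_filter x) id x cvg_id _ e0.
apply: filterS => y; congr (_ < _).
by rewrite -absR_of_real; congr absR; rewrite of_realD /of_real; case: k => //=; rewrite raddfN.
Qed.

Lemma re_continuous : continuous (re : K^o -> R^o).
Proof.
move=> x; apply/(@cvgrPdist_lt _ R^o _ (nbhs x) (nbhs_filter x)) => e e0.
have := (cvg_absRP (nbhs_filter x) (fun y => y) x).1 cvg_id _ e0.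
by apply: filterS => y; apply: le_lt_trans; rewrite -reB; exact: re_norm_le.
Qed.

Lemma im_continuous : continuous (im : K^o -> R^o).
Proof.
move=> x; apply/(@cvgrPdist_lt _ R^o _ (nbhs x) (nbhs_filter x)) => e e0.
have := (cvg_absRP (nbhs_filter x) (fun y => y) x).1 cvg_id _ e0.
by apply: filterS => y; apply: le_lt_trans; rewrite -imB; exact: im_norm_le.
Qed.

Lemma cvg_re_im (T : Type) (F : set_system T) (FF : Filter F) (f : T -> K^o) (a b : R) :
  (fun x => re (f x)) @ F --> (a : R^o) -> (fun x => im (f x)) @ F --> (b : R^o) ->
  f @ F --> (of_real a + imag_unit * of_real b : K^o).
Proof.
move=> fa fb.
have -> : f = (fun x => of_real (re (f x)) + imag_unit * of_real (im (f x))).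
  by apply/funext => x; exact: re_im.
apply: cvgD.
  by apply: (cvg_comp _ _ fa); exact: of_real_continuous.
apply: (@cvgMr _ T F FF (fun x => of_real (im (f x)))).
by apply: (cvg_comp _ _ fb); exact: of_real_continuous.
Qed.

(** Completeness of [R] is applied to the real and imaginary parts, which are 1-Lipschitz; this
    treats both scalar fields at once. *)
Lemma scalar_cauchy_cvg (u : nat -> K^o) :
  (forall e : R, 0 < e -> exists N, forall m n, (N <= m)%N -> (N <= n)%N -> absR (u m - u n) < e) ->
  exists l : K^o, u @ \oo --> l.
Proof.
move=> cu.
have real_case (v : nat -> R^o) :
    (forall m n, `|v m - v n| <= absR (u m - u n)) -> cvgn v.
  move=> vu; apply/cauchy_cvgP/cauchy_exP => e e0.
  have [N NP] := cu _ e0; exists (v N).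
  exists N => // n /= Nn; rewrite /ball/=; apply: le_lt_trans (vu _ _) _.
  exact: NP.
have ru : cvgn (fun n => re (u n) : R^o).
  by apply: real_case => m n; rewrite -reB re_norm_le.
have iu : cvgn (fun n => im (u n) : R^o).
  by apply: real_case => m n; rewrite -imB im_norm_le.
by eexists; apply: cvg_re_im; [exact: ru|exact: iu].
Qed.

Lemma scalar_cvg_unique (u : nat -> K^o) (l l' : K^o) :
  u @ \oo --> l -> u @ \oo --> l' -> l = l'.
Proof.
move=> ul ul'; have e1 := cvg_lim (@norm_hausdorff _ K^o) ul.
have e2 := cvg_lim (@norm_hausdorff _ K^o) ul'.
by rewrite -e1 -e2.
Qed.

Lemma absR_cvg_le (u : nat -> K^o) (l : K^o) (c : R) :
  u @ \oo --> l -> (\forall n \near \oo, absR (u n) <= c) -> absR l <= c.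
Proof.
move=> ul uc; apply/ler_addgt0Pr => e e0.
have /cvg_absRP/(_ _ e0) le := ul.
near \oo => n.
have : absR l <= absR (l - u n) + absR (u n).
  by rewrite -[in leLHS](subrK (u n) l) absRD.
move/le_trans; apply; rewrite addrC lerD//; first by near: n.
by apply: ltW; near: n.
Unshelve. all: by end_near. Qed.

Lemma scalar_normed_series_cvg (z : nat -> K) (M : R) :
  (forall n, \sum_(i < n) absR (z i) <= M) ->
  exists l : K^o, (fun n => \sum_(i < n) z i : K^o) @ \oo --> l.
Proof.
move=> zM; apply: scalar_cauchy_cvg => e e0.
pose s n : R^o := \sum_(i < n) absR (z i).
have cs : cvgn s by exact: nonneg_series_is_cvg (fun n => absR_ge0 (z n)) zM.
have e20 : 0 < e / 2 by rewrite divr_gt0.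
have /(@cvgrPdist_lt _ R^o)/(_ _ e20)[N _ NP] := cs.
exists N => m n; wlog nm : m n / (n <= m)%N.
  move=> h Nm Nn; have [nm|mn] := leqP n m; first exact: h.
  by rewrite absRB; apply: h => //; exact: ltnW.
move=> Nm Nn.
have -> : \sum_(i < m) z i - \sum_(i < n) z i = \sum_(n <= i < m) z i.
  exact: sum_ordB.
apply: le_lt_trans (absR_sum _ _ _) _.
have -> : \sum_(n <= i < m) absR (z i) = s m - s n.
  by rewrite -(sum_ordB (fun i => absR (z i)) nm).
have := NP m Nm; have := NP n Nn; rewrite /= !ltr_norml.
by move=> /andP[? ?] /andP[? ?]; lra.
Qed.

(* The net consists of the normalised nonzero points of a grid. *)
Lemma unimodular_net (e : R) : 0 < e ->
  exists s : seq K, (forall u, u \in s -> absR u = 1) /\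
    forall z : K, absR z = 1 -> exists2 u, u \in s & absR (z - u) <= e.
Proof.
(* The term [4 / e] makes the grid error [2 / N] at most [e / 2], and normalising costs as much
   again; the extra [4] gives [2 / N < 1], so the chosen grid point is nonzero. *)
move=> e0; pose N := (Num.truncn (4 / e + 4)).+1.
have N4 : 4 / e + 4 < N%:R.
  by have /truncn_itv/andP[] : 0 <= 4 / e + 4 by rewrite addr_ge0// divr_ge0 ?ltW.
have e4 : 0 < 4 / e by rewrite divr_gt0.
have N0 : 0 < N%:R :> R by lra.
have Ne : 2 / N%:R <= e / 2 :> R.
  rewrite ler_pdivrMr// -ler_pdivrMl ?divr_gt0// invf_div.
  by have : 2 / e * 2 = 4 / e by [ring]; lra.
have N1 : 2 / N%:R < 1 :> R by rewrite ltr_pdivrMr// mul1r; lra.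
pose x (a : 'I_(2 * N).+1) : R := a%:R / N%:R - 1.
have xP (y : R) : `|y| <= 1 -> exists a, `|y - x a| <= N%:R^-1.
  rewrite ler_norml => /andP[y1 y2].
  have /truncn_itv/andP[] : 0 <= (y + 1) * N%:R by rewrite mulr_ge0 ?(ltW N0)//; lra.
  set a := Num.truncn _ => a1; rewrite -natr1 => a2.
  have aN : (a < (2 * N).+1)%N.
    rewrite ltnS -(ler_nat R) (le_trans a1)// natrM ler_wpM2r ?(ltW N0)//; lra.
  exists (Ordinal aN); rewrite /x /= ler_norml.
  have -> : y - (a%:R / N%:R - 1) = ((y + 1) * N%:R - a%:R) / N%:R.
    by field; rewrite gt_eqF.
  rewrite -[X in - X]mul1r -[X in _ && (_ <= X)]mul1r -mulNr.
  by rewrite !ler_pM2r ?invr_gt0//; apply/andP; split; lra.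
pose w (ab : 'I_(2 * N).+1 * 'I_(2 * N).+1) : K :=
  of_real (x ab.1) + imag_unit * of_real (x ab.2).
pose nz (v : K) := of_real (absR v)^-1 * v.
exists [seq nz (w ab) | ab <- enum [pred ab | w ab != 0]]; split.
  move=> u /mapP[ab]; rewrite mem_enum inE -absR_gt0 => wab ->.
  by rewrite /nz absRM absR_of_real gtr0_norm ?invr_gt0// mulVf ?gt_eqF.
move=> z z1.
have [a az] : exists a, `|re z - x a| <= N%:R^-1.
  by apply: xP; rewrite -z1 re_norm_le.
have [b bz] : exists b, `|im z - x b| <= N%:R^-1.
  by apply: xP; rewrite -z1 im_norm_le.
have zw : absR (z - w (a, b)) <= 2 / N%:R.
  have -> : z - w (a, b) = of_real (re z - x a) + imag_unit * of_real (im z - x b).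
    rewrite {1}(re_im z) /w /=; move: (x a) (x b) => xa xb.
    by rewrite !of_realD !of_realN; ring.
  apply: le_trans (absRD _ _) _; rewrite absRM !absR_of_real.
  have : absR (imag_unit : K) * `|im z - x b| <= 1 * N%:R^-1.
    by rewrite ler_pM ?absR_ge0// absR_imag_unit.
  by have : 2 / N%:R = N%:R^-1 + 1 * N%:R^-1 :> R by [ring]; lra.
have zw1 : `|1 - absR (w (a, b))| <= 2 / N%:R.
  apply: le_trans zw; rewrite ler_norml.
  have := absRD (z - w (a, b)) (w (a, b)); rewrite subrK z1.
  have := absRD (w (a, b) - z) z; rewrite subrK z1 absRB.
  by move=> ? ?; apply/andP; split; lra.
have w0 : 0 < absR (w (a, b)).
  by move: zw1; rewrite ler_norml => /andP[? ?]; lra.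
exists (nz (w (a, b))).
  by apply/mapP; exists (a, b) => //; rewrite mem_enum inE -absR_gt0.
have -> : z - nz (w (a, b)) = (z - w (a, b)) + (w (a, b) - nz (w (a, b))).
  by rewrite addrA subrK.
apply: le_trans (absRD _ _) _.
have -> : absR (w (a, b) - nz (w (a, b))) = `|1 - absR (w (a, b))|.
  have oV : of_real (absR (w (a, b)) - 1) * nz (w (a, b)) = w (a, b) - nz (w (a, b)).
    rewrite /nz mulrA -of_realM mulrBl mul1r mulfV ?gt_eqF//.
    rewrite of_realD mulrDl.
    by rewrite of_real1 of_realN mul1r mulNr.
  rewrite -oV absRM /nz absRM !absR_of_real (gtr0_norm (_ : 0 < _^-1)) ?invr_gt0//.
  by rewrite mulVf ?gt_eqF// mulr1 distrC.
by apply: le_trans (lerD zw zw1) _; lra.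
Qed.

End scalars.

(** * Real-valued norms, bounded operators and functionals *)

Section real_norm.
Context {R : realType} {k : scalars}.
Local Notation K := (scalar_field R k).

Lemma closure_nrmP (V : normedModType K) (A : set V) (x : V) :
  closure A x -> forall e : R, 0 < e -> exists2 y, A y & nrm (x - y) < e.
Proof.
move=> clx e e0.
have /clx[y [Ay xy]] : nbhs x [set y | nrm (x - y) < e].
  by apply: (cvg_nrmP (nbhs_filter x) id x).1.
by exists y.
Qed.

Lemma linear_bounded (V W : normedModType K) (f : {linear V -> W}) :
  continuous f -> exists2 M : R, 0 < M & forall x, nrm (f x) <= M * nrm x.
Proof.
move=> /linear_bounded_continuous/linear_boundedP.
move=> /pinfty_ex_gt0[M M0 fM]; have M'0 : 0 < re M.
  by rewrite -(@ltr_of_real R k) of_real0 ge0_of_real_re// ltW.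
exists (re M) => // x; rewrite -(@ler_of_real R k) of_realM !of_real_nrm.
by rewrite ge0_of_real_re ?fM// ltW.
Qed.

Lemma lipschitz_continuous (V W : normedModType K) (f : V -> W) (M : R) :
  (forall x y, nrm (f x - f y) <= M * nrm (x - y)) -> continuous f.
Proof.
move=> fM x; apply/cvg_nrmP => e e0.
have d0 : 0 < e / (`|M| + 1) by rewrite divr_gt0// ltr_wpDl.
have := (cvg_nrmP (nbhs_filter x) id x).1 cvg_id _ d0.
apply: filterS => y; rewrite ltr_pdivlMr ?ltr_wpDl// => xy.
apply: le_lt_trans (fM x y) _; apply: le_lt_trans xy; rewrite mulrC.
by rewrite ler_wpM2l ?nrm_ge0// (le_trans (ler_norm _))// lerDl.
Qed.

Lemma nrm_le_continuous (V W : normedModType K) (f : {linear V -> W}) (M : R) :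
  (forall x, nrm (f x) <= M * nrm x) -> continuous f.
Proof.
by move=> fM; apply: (@lipschitz_continuous _ _ _ M) => x y; rewrite -raddfB fM.
Qed.

(** Maps built by pointwise choice are proved linear only afterwards; this turns them into
    morphisms. *)
Lemma linear_bundle (V W : lmodType K) (f : V -> W) :
  linear f -> exists g : {linear V -> W}, g =1 f.
Proof.
move=> lf; pose fL := GRing.isLinear.Build K V W _ f lf.
pose g : {linear V -> W} := HB.pack f fL.
by exists g.
Qed.

(* The inverse on the image is Lipschitz with constant [c^-1]. *)
Lemma bounded_below_iso_onto_image (V W : normedModType K) (A : set V)
    (f : {linear V -> W}) (c : R) :
  submod_closed [in A] -> continuous f -> 0 < c ->
  (forall x, A x -> c * nrm x <= nrm (f x)) -> iso_onto_image A f.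
Proof.
move=> [_ Al] cf c0 fc; split; first exact: continuous_subspaceT.
have AB x y : A x -> A y -> A (x - y).
  move=> Ax Ay; have := Al (-1) y x; rewrite !inE scaleN1r addrC.
  by apply.
(* The default [0] is returned only off the image of [A], where continuity of [g] is not claimed. *)
pose g w := xget 0 [set x | A x /\ f x = w].
have fK x : A x -> g (f x) = x.
  move=> Ax; rewrite /g; case: xgetP => [y _ [Ay fyx]|/(_ x)[]//].
  apply/eqP; rewrite -subr_eq0; apply/eqP/nrm_eq0/eqP; rewrite eq_le nrm_ge0 andbT.
  have := fc _ (AB _ _ Ay Ax); rewrite raddfB/= fyx subrr nrm0.
  by rewrite pmulr_rle0.
exists g; first by move=> x; rewrite inE; exact: fK.
apply/subspace_continuousP => _ [x Ax <-]; apply/cvg_nrmP => e e0.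
have ce0 : 0 < c * e by rewrite mulr_gt0.
have := (cvg_nrmP (nbhs_filter (f x)) id (f x)).1 cvg_id _ ce0.
apply: filterS => w fxw [y Ay fy]; rewrite /from_subspace -fy !fK// -(ltr_pM2l c0).
by apply: le_lt_trans (fc _ (AB _ _ Ax Ay)) _; rewrite raddfB/= fy.
Qed.

(** Boundedness on the unit ball is settled first, since the supremum in the dual norm is an upper
    bound only for bounded sets; homogeneity then gives all [z]. *)
Lemma dual_absR_le (Z : normedModType K) (phi : dual Z) (z : Z) :
  absR (phi z) <= nrm phi * nrm z.
Proof.
have -> : nrm phi = sup [set absR (phi x) | x in [set z | `|z| <= 1]].
  exact: of_realK.
have [M M0 phiM] : exists2 M : R, 0 < M & forall x, nrm (phi x : K^o) <= M * nrm x.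
  by apply: (@linear_bounded Z K^o phi); exact: dual_continuous.
have bphi : bounded_fct [set z | `|z| <= 1] phi.
  exists M => _ [x /= x1 <-]; apply: le_trans (phiM x) _.
  by rewrite -[leRHS]mulr1 ler_wpM2l ?(ltW M0)// -nrm_le1P.
have [->|z0] := eqVneq z 0; first by rewrite linear0 absR0 nrm0 mulr0.
have nz : 0 < nrm z.
  by rewrite lt_neqAle nrm_ge0 andbT eq_sym; apply: contra_neq z0; exact: nrm_eq0.
rewrite -ler_pdivrMr//.
have -> : absR (phi z) / nrm z = absR (phi (of_real k (nrm z)^-1 *: z)).
  rewrite linearZ/= absRM absR_of_real ger0_norm ?invr_ge0 ?nrm_ge0//.
  by rewrite mulrC.
apply: sup_ub => //=; rewrite nrm_le1P nrmZ absR_of_real.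
by rewrite ger0_norm ?invr_ge0 ?nrm_ge0// mulVf// gt_eqF.
Qed.

Lemma dual_nrm_le (Z : normedModType K) (phi : dual Z) (c : R) : 0 <= c ->
  (forall z, nrm z <= 1 -> absR (phi z) <= c) -> nrm phi <= c.
Proof.
move=> c0 phic.
have -> : nrm phi = sup [set absR (phi x) | x in [set z | `|z| <= 1]].
  exact: of_realK.
by apply: Defs.sup_le => // z /=; rewrite nrm_le1P; exact: phic.
Qed.

Lemma dual_of_bounded (Z : normedModType K) (f : Z -> K) (c : R) :
  linear (f : Z -> K^o) -> (forall z, absR (f z) <= c * nrm z) ->
  exists phi : dual Z, phi =1 f.
Proof.
move=> lf fc; have [g gf] := linear_bundle lf.
have cf : continuous (f : Z -> K^o).
  have -> : (f : Z -> K^o) = g by apply/funext => z; rewrite gf.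
  by apply: (@nrm_le_continuous Z K^o g c) => z; rewrite gf; exact: fc.
have fP : (f : Z -> K^o) \in @dual_pred R k Z by rewrite inE.
by exists (Dual fP).
Qed.

End real_norm.

(** * Continuous functions and membership in X(E) *)

Section function_spaces.
Context {R : realType} {k : scalars}.
Local Notation K := (scalar_field R k).

Lemma cspace_absR_le (T : topologicalType) (cT : compact [set: T])
  (f : @cspace R k T cT) (x : T) : absR (f x) <= nrm f.
Proof.
have -> : nrm f = sup [set absR (f x) | x in [set: T]] by exact: of_realK.
apply: sup_ub => //.
have := cspace_funP f; rewrite inE/= => cf.
have /compact_bounded : compact ((@absR R k \o f : T -> R^o) @` [set: T]).
  apply: continuous_compact => //; apply: continuous_subspaceT => y.
  by apply: continuous_comp; [exact: cf|exact: absR_continuous].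
move=> /pinfty_ex_gt0[M _ fM]; exists M => _ [y _ <-].
by apply: le_trans (fM (absR (f y)) _); [exact: ler_norm|exists y].
Qed.

Lemma cspace_nrm_le (T : topologicalType) (cT : compact [set: T])
  (f : @cspace R k T cT) (c : R) : 0 <= c -> (forall x, absR (f x) <= c) -> nrm f <= c.
Proof.
move=> c0 fc.
have -> : nrm f = sup [set absR (f x) | x in [set: T]] by exact: of_realK.
by apply: Defs.sup_le => // x _; exact: fc.
Qed.

Lemma cspace_continuous (T : topologicalType) (cT : compact [set: T])
  (f : @cspace R k T cT) : continuous f.
Proof. by have := cspace_funP f; rewrite inE. Qed.

Context {V : normedModType K} {J : {linear V -> C_cantor R k}}.
Local Notation X := (X_space J).
Local Notation I01 := (set_type (`[0, 1]%classic : set R)).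

Lemma X_absR_le (f : X) (t : I01) : absR (X_fun f t) <= nrm f.
Proof. exact: (cspace_absR_le (X_fun f)). Qed.

Lemma X_nrm_le (f : X) (c : R) : 0 <= c -> (forall t, absR (X_fun f t) <= c) -> nrm f <= c.
Proof. exact: (@cspace_nrm_le _ _ (X_fun f)). Qed.

Lemma X_continuous (f : X) : continuous (X_fun f : I01 -> K^o).
Proof. exact: (@cspace_continuous _ _ (X_fun f)). Qed.

Lemma X_ext (f g : X) : (forall t, X_fun f t = X_fun g t) -> f = g.
Proof. by move=> fg; apply/val_inj/val_inj/funext. Qed.

Lemma X_spaceP (h : I01 -> K^o) (v : V) : continuous h ->
  (forall x : cantor_middle_third, h (cantor_incl x) = J v x) ->
  exists f : X, X_fun f =1 h.
Proof.
move=> ch hv.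
have hP : h \in @continuous_fct R k I01 by rewrite inE.
pose f : C01 R k := @CSpace R k I01 (compact_set_type (@compact_unit R)) h hP.
have fP : f \in X_pred J by rewrite inE/=; exists v; apply/funext => x /=; exact: hv.
by exists (XSpace fP).
Qed.

Lemma X_restriction (f : X) :
  exists v, forall x : cantor_middle_third, X_fun f (cantor_incl x) = J v x.
Proof.
have := X_funP f; rewrite inE/= => -[v fv]; exists v => x.
by have := congr1 (fun g => g x) fv.
Qed.

Lemma set_val_continuous (A : set R) : continuous (set_val : A -> R^o).
Proof. exact: initial_continuous. Qed.

(** Translates the subtype topology of the segment into distances in [R], so that continuity becomes
    an epsilon-delta estimate. *)
Lemma segment_nbhsP (t : I01) (P : set I01) :
  nbhs t P <-> exists2 d : R, 0 < d & forall s : I01, `|set_val s - set_val t| < d -> P s.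
Proof.
split=> [[_ [/= [V' oV <-] Vt] VP]|[d d0 dP]].
  have /nbhs_ballP[d /= d0 dV] : nbhs (set_val t : R^o) V' by exact: open_nbhs_nbhs.
  by exists d => // s st; apply: VP => /=; apply: dV; rewrite /ball/= distrC.
have : nbhs (set_val t : R^o) (ball (set_val t : R^o) d) by exact: nbhsx_ballx.
move=> /set_val_continuous; rewrite nbhs_simpl/=; apply: filterS => s /=.
by rewrite /ball/= distrC; exact: dP.
Qed.

Lemma X_epsilon_delta (f : X) (t : I01) (e : R) : 0 < e ->
  exists2 d : R, 0 < d & forall s : I01,
    `|set_val s - set_val t| < d -> absR (X_fun f t - X_fun f s) < e.
Proof.
move=> e0; apply/segment_nbhsP.
by have /cvg_absRP := @X_continuous f t; apply.
Qed.

End function_spaces.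

(** * The sequence spaces l1 and l2 *)

Section ell_facts.
Context {R : realType} {k : scalars}.
Local Notation K := (scalar_field R k).

Lemma ell_sum_leP (p : R) (x : nat -> K^o) (c : R) :
  (ell_sum (p := p) x <= c%:E)%E <-> forall n, \sum_(i < n) absR (x i) `^ p <= c.
Proof.
have t0 i : xpredT i -> (0 <= (absR (x i) `^ p)%:E)%E by rewrite lee_fin powR_ge0.
split=> [xc n|xc].
  rewrite -lee_fin; apply: le_trans xc; rewrite -sumEFin.
  rewrite -(big_mkord xpredT (fun i => (absR (x i) `^ p)%:E)).
  by apply: nneseries_lim_ge => i _ _; exact: t0.
apply: lime_le; first by apply: is_cvg_nneseries => i _ _; exact: t0.
apply: nearW => n.
by rewrite /= big_mkord sumEFin lee_fin.
Qed.

Lemma ell_sum_ge0 (p : R) (x : nat -> K^o) : (0 <= ell_sum (p := p) x)%E.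
Proof. by apply: nneseries_ge0 => i _ _; rewrite lee_fin powR_ge0. Qed.

Lemma ell_sum_fineK (p : R) (p1 : 1 <= p) (x : ell R k p1) :
  ((fine (ell_sum (p := p) x))%:E = ell_sum (p := p) x)%E.
Proof. by have := ell_funP x; rewrite inE/= => h; rewrite fineK// ge0_fin_numE// ell_sum_ge0. Qed.

Lemma nrm_ellE (p : R) (p1 : 1 <= p) (x : ell R k p1) :
  nrm x = fine (ell_sum (p := p) x) `^ p^-1.
Proof. exact: of_realK. Qed.

Lemma ell_mk (p : R) (p1 : 1 <= p) (x : nat -> K^o) (c : R) :
  (forall n, \sum_(i < n) absR (x i) `^ p <= c) ->
  exists a : ell R k p1, ell_fun a =1 x.
Proof.
move=> /ell_sum_leP xc.
have xP : x \in @summable_pow R k p by rewrite inE/= (le_lt_trans xc)// ltry.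
by exists (Ell p1 xP).
Qed.

Lemma ell1_sum_le (a : ell1 R k) (n : nat) : \sum_(i < n) absR (ell_fun a i) <= nrm a.
Proof.
rewrite nrm_ellE invr1 powRr1 ?fine_ge0 ?ell_sum_ge0//.
have := (ell_sum_leP 1 (ell_fun a) (fine (ell_sum (p := 1) (ell_fun a)))).1.
rewrite (ell_sum_fineK a) lexx => /(_ isT n); apply: le_trans.
by apply: ler_sum => i _; rewrite powRr1 ?absR_ge0.
Qed.

Lemma ell1_nrm_le (a : ell1 R k) (c : R) :
  (forall n, \sum_(i < n) absR (ell_fun a i) <= c) -> nrm a <= c.
Proof.
move=> ac; rewrite nrm_ellE invr1 powRr1 ?fine_ge0 ?ell_sum_ge0//.
rewrite -lee_fin (ell_sum_fineK a); apply/ell_sum_leP => n; apply: le_trans (ac n).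
by apply: ler_sum => i _; rewrite powRr1 ?absR_ge0.
Qed.

Lemma ell1_mk (x : nat -> K^o) (c : R) :
  (forall n, \sum_(i < n) absR (x i) <= c) -> exists a : ell1 R k, ell_fun a =1 x.
Proof.
move=> xc; apply: (@ell_mk 1 _ x c) => n; apply: le_trans (xc n).
by apply: ler_sum => i _; rewrite powRr1 ?absR_ge0.
Qed.

(** This monotonicity makes deleting one coordinate a contraction of l2, which is the source of the
    contractions on the dual. *)
Lemma ell2_le (x y : ell2 R k) :
  (forall i, absR (ell_fun x i) <= absR (ell_fun y i)) -> nrm x <= nrm y.
Proof.
move=> xy; rewrite !nrm_ellE ge0_ler_powR ?nnegrE ?fine_ge0 ?ell_sum_ge0 ?invr_ge0//.
rewrite -lee_fin !ell_sum_fineK; apply: lee_nneseries => i _.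
  by move=> _; rewrite lee_fin powR_ge0.
by rewrite lee_fin ge0_ler_powR ?nnegrE ?absR_ge0.
Qed.

Lemma ell2_delta (n : nat) :
  exists e : ell2 R k, forall i, ell_fun e i = if i == n then 1 else 0.
Proof.
apply: (@ell_mk 2 _ _ 1) => m.
have [nm|mn] := ltnP n m.
  rewrite (bigD1 (Ordinal nm))//= eqxx absR1 powR1 big1 ?addr0// => i /negP ni.
  case: eqP => [ni'|_]; last by rewrite absR0 powR0// gt_eqF.
  by case: ni; apply/eqP/val_inj.
rewrite big1// => i _; case: eqP => [ni|_]; last by rewrite absR0 powR0// gt_eqF.
by have := ltn_ord i; rewrite ni ltnNge mn.
Qed.

Lemma ell_funZ (p : R) (p1 : 1 <= p) (c : K) (x : ell R k p1) i :
  ell_fun (c *: x) i = c * ell_fun x i.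
Proof. by []. Qed.

End ell_facts.

(** * Cut-off functions *)

Section cutoffs.
Context {R : realType}.

Definition dist_to (A : set R) (x : R) : R := inf [set `|x - y| | y in A].

Lemma dist_to_ge0 (A : set R) (x : R) : 0 <= dist_to A x.
Proof.
have [->|/set0P[y Ay]] := eqVneq A set0; first by rewrite /dist_to image_set0 inf0.
by apply: lb_le_inf; [exists `|x - y|, y|move=> _ [z _ <-]].
Qed.

Lemma dist_to_le (A : set R) (x y : R) : A y -> dist_to A x <= `|x - y|.
Proof. by move=> Ay; apply: ge_inf; [exists 0 => _ [z _ <-]|exists y]. Qed.

Lemma dist_to_eq0 (A : set R) (x : R) : A x -> dist_to A x = 0.
Proof.
move=> Ax; apply/eqP; rewrite eq_le dist_to_ge0 andbT.
by have := dist_to_le x Ax; rewrite subrr normr0.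
Qed.

Lemma dist_to_lt (A : set R) (x e : R) : A !=set0 -> dist_to A x < e ->
  exists2 y, A y & `|x - y| < e.
Proof.
move=> [y Ay] xe.
have [] := @inf_adherent _ [set `|x - y| | y in A] (e - dist_to A x).
- by rewrite subr_gt0.
- by split; [exists `|x - y|, y|exists 0 => _ [z _ <-]].
by move=> _ [z Az <-]; rewrite -/(dist_to A x) [ltRHS]addrC subrK => h; exists z.
Qed.

Lemma dist_to_lipschitz (A : set R) (x y : R) : A !=set0 ->
  `|dist_to A x - dist_to A y| <= `|x - y|.
Proof.
move=> A0; wlog xy : x y / dist_to A y <= dist_to A x.
  move=> h; have [/h//|/ltW/h] := leP (dist_to A y) (dist_to A x).
  by rewrite distrC (distrC y).
rewrite ger0_norm ?subr_ge0// lerBlDr; apply/ler_addgt0Pr => e e0.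
have [|z Az yz] := @dist_to_lt A y (dist_to A y + e) A0; first by rewrite ltrDl.
apply: le_trans (dist_to_le x Az) _.
have -> : x - z = (x - y) + (y - z) by rewrite addrA subrK.
by rewrite -(addrA `|x - y|) (le_trans (ler_normD _ _))// lerD2l ltW.
Qed.

Lemma dist_to_continuous (A : set R) : A !=set0 -> continuous (dist_to A : R^o -> R^o).
Proof.
move=> A0 x; apply/(@cvgrPdist_lt _ R^o _ (nbhs x) (nbhs_filter x)) => e e0.
have := @cvgr_dist_lt _ R^o _ _ (nbhs_filter x) id x cvg_id _ e0.
by apply: filterS => y /=; apply: le_lt_trans; exact: dist_to_lipschitz.
Qed.

(* [ramp n d] increases in [n] to the indicator function of [d > 0]. *)
Definition ramp (n : nat) (d : R) : R := Num.min 1 (2 ^+ n * d).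

Lemma ramp_continuous n : continuous (ramp n : R^o -> R^o).
Proof.
move=> x; apply: (@continuous_min R^o _ (fun=> 1) (fun d : R^o => 2 ^+ n * d)).
  exact: cvg_cst.
by apply: cvgMr; exact: cvg_id.
Qed.

Lemma ramp_itv n (d : R) : 0 <= d -> 0 <= ramp n d <= 1.
Proof. by move=> d0; rewrite le_min ler01 mulr_ge0 ?exprn_ge0//= ge_min lexx. Qed.

Lemma ramp_le n (d : R) : 0 <= d -> ramp n d <= ramp n.+1 d.
Proof.
move=> d0; rewrite le_min ge_min lexx/= /ramp ge_min; apply/orP; right.
by rewrite ler_wpM2r// exprS ler_peMl ?exprn_ge0// ler1n.
Qed.

Lemma ramp0 n : ramp n 0 = 0. Proof. by rewrite /ramp mulr0 min_r. Qed.

Lemma ramp_eq1 n (d : R) : 1 <= 2 ^+ n * d -> ramp n d = 1.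
Proof. by move=> d1; rewrite /ramp min_l. Qed.

Lemma pow2_archi (d : R) : 0 < d -> \forall n \near \oo, 1 <= 2 ^+ n * d.
Proof.
move=> d0; exists (Num.truncn d^-1).+1 => // n /= dn.
rewrite -ler_pdivrMr// div1r.
have /truncn_itv/andP[_ /ltW] : 0 <= d^-1 by rewrite invr_ge0 ltW.
move/le_trans; apply; apply: le_trans (_ : n%:R <= _); first by rewrite ler_nat.
by rewrite -natrX ler_nat ltnW// ltn_expl.
Qed.

End cutoffs.

(** * Summability of functionals along weakly unconditionally Cauchy series *)

Section weakly_unconditionally_cauchy.
Context {R : realType} {k : scalars}.
Local Notation K := (scalar_field R k).

(** Multiplying each [psi i] by the conjugate phase of [phi (psi i)] makes all values nonnegative,
    so the sum of moduli is one value of [phi] at a vector of norm at most [C]. *)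
Lemma dual_series_le (Z : normedModType K) (phi : dual Z) (psi : nat -> Z) (C : R) n :
  (forall c : nat -> K, (forall i, absR (c i) <= 1) ->
    nrm (\sum_(i < n) c i *: psi i) <= C) ->
  \sum_(i < n) absR (phi (psi i)) <= nrm phi * C.
Proof.
(* The conjugate phase; where [phi (psi i)] vanishes, the convention [0^-1 = 0] makes the
   coefficient [0]. *)
move=> psiC; pose c i : K := of_real k (absR (phi (psi i))) * (phi (psi i))^-1.
have cE i : c i * phi (psi i) = of_real k (absR (phi (psi i))).
  rewrite /c; have [->|z0] := eqVneq (phi (psi i)) 0.
    by rewrite mulr0 absR0 of_real0.
  by rewrite mulfVK.
have c1 i : absR (c i) <= 1.
  rewrite /c absRM absR_of_real ger0_norm ?absR_ge0// absRV.
  have [->|z0] := eqVneq (absR (phi (psi i))) 0; first by rewrite mul0r.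
  by rewrite mulfV.
have sE : \sum_(i < n) absR (phi (psi i)) = absR (phi (\sum_(i < n) c i *: psi i)).
  rewrite linear_sum/=.
  under [in RHS]eq_bigr => i _ do rewrite linearZ/= [_ *: _]cE.
  rewrite -(big_morph _ (@of_realD R k) (@of_real0 R k)) absR_of_real ger0_norm//.
  by apply: sumr_ge0 => i _; exact: absR_ge0.
rewrite sE; apply: le_trans (dual_absR_le _ _) _.
by rewrite ler_wpM2l ?nrm_ge0// psiC.
Qed.

Context {V : normedModType K} {J : {linear V -> C_cantor R k}}.
Local Notation X := (X_space J).
Local Notation I01 := (set_type (`[0, 1]%classic : set R)).

Lemma X_fun_sum n (c : 'I_n -> K) (f : 'I_n -> X) t :
  X_fun (\sum_(i < n) c i *: f i) t = \sum_(i < n) c i * X_fun (f i) t.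
Proof.
apply: (big_ind2 (fun (g : X) (y : K) => X_fun g t = y)) => //.
by move=> g y h z <- <-.
Qed.

(** In the supremum norm a pointwise bound on sums of moduli controls all combinations with
    coefficients in the unit disc simultaneously. *)
Lemma X_dual_series_le (phi : dual X) (psi : nat -> X) (C : R) n : 0 <= C ->
  (forall t, \sum_(i < n) absR (X_fun (psi i) t) <= C) ->
  \sum_(i < n) absR (phi (psi i)) <= nrm phi * C.
Proof.
move=> C0 psiC; apply: dual_series_le => c c1; apply: X_nrm_le => // t.
rewrite X_fun_sum; apply: le_trans (absR_sum _ _ _) _; apply: le_trans (psiC t).
by apply: ler_sum => i _; rewrite absRM ler_piMl ?absR_ge0.
Qed.

Lemma continuous_patch (T : topologicalType) (f : T -> K^o) (chi : T -> R^o) (u : K) :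
  continuous f -> continuous chi ->
  continuous (fun t => f t + of_real k (chi t) * (u - f t) : K^o).
Proof.
move=> cf cchi t; apply: cvgD; first exact: cf.
apply: (@cvgM K).
  by apply: (continuous_comp (cchi t)); exact: of_real_continuous.
by apply: cvgB; [exact: cvg_cst|exact: cf].
Qed.

(** Interpolates between [f] where [chi] is 0 and the constant [u] where [chi] is 1. As [chi]
    vanishes on the Cantor set, the restriction there is unchanged and the result stays in X(E). *)
Lemma X_patch (f : X) (chi : I01 -> R^o) (u : K) : continuous chi ->
  (forall x : cantor_middle_third, chi (cantor_incl x) = 0) ->
  exists g : X, forall t,
    X_fun g t = X_fun f t + of_real k (chi t) * (u - X_fun f t).
Proof.
move=> cchi chi0; have [v fv] := X_restriction f.
have ch := continuous_patch (u := u) (@X_continuous _ _ _ _ f) cchi.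
have [x|g gh] := @X_spaceP _ _ _ J _ v ch; last by exists g.
by rewrite chi0 of_real0 mul0r addr0 fv.
Qed.

End weakly_unconditionally_cauchy.

(** * Extension from the Cantor set to the segment *)

Section cantor_extension.
Context {R : realType}.

Lemma continuous_set_val_comp (A : set R) (h : R^o -> R^o) :
  continuous h -> continuous (fun t : A => h (set_val t)).
Proof. by move=> ch t; apply: (continuous_comp (@set_val_continuous _ A t)); exact: ch. Qed.

Lemma cantor0 : (@cantor_middle_third R) 0.
Proof.
move=> n _; elim: n => [|n IH]/=; first by rewrite in_itv/= lexx ler01.
by left; exists 0; rewrite ?mul0r.
Qed.

Lemma closed_cantor : closed (@cantor_middle_third R : set R^o).
Proof. by apply: closed_bigI => n _; exact: closed_cantor_stage. Qed.

(** Tietze's extension theorem on the real line, for the closed Cantor set. *)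
Lemma cantor_real_extension (f : cantor_middle_third -> R^o) (M : R) :
  continuous f -> (forall x, `|f x| <= M) ->
  exists2 g : R^o -> R^o, continuous g & forall x, g (set_val x) = f x.
Proof.
(* The value [0] off the Cantor set only makes [h] total; continuity is claimed within the Cantor
   set. *)
move=> cf fM; pose h (x : R^o) : R^o := oapp f 0 (insub x).
have hE (x : cantor_middle_third) : h (set_val x) = f x.
  by rewrite /h /= valK.
have ch : {within (@cantor_middle_third R : set R^o), continuous h}.
  apply/subspace_continuousP => x Ax; pose x' : @cantor_middle_third R := SigSub (mem_set Ax).
  apply/(@cvgrPdist_lt _ R^o) => e e0.
  have /(@cvgrPdist_lt _ R^o)/(_ _ e0) := cf x'.
  move=> -[_ [/= [V' oV <-] Vx] VP].
  have : nbhs (x : R^o) V' by exact: open_nbhs_nbhs.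
  apply: filterS => y Vy Ay; pose y' : @cantor_middle_third R := SigSub (mem_set Ay).
  by have /= := VP y' Vy; rewrite -(hE x') -(hE y').
(* Tietze's theorem takes a positive bound, hence [|M| + 1] in place of [M]. *)
have [] := @continuous_bounded_extension R^o R (@pseudometric_normal R R^o)
  (@cantor_middle_third R) closed_cantor h (`|M| + 1) _ ch.
- by rewrite ltr_wpDl.
- move=> x Ax; pose x' : @cantor_middle_third R := SigSub (mem_set Ax).
  rewrite -[x]/(set_val x') hE (le_trans (fM x'))//.
  by rewrite (le_trans (ler_norm _))// lerDl.
move=> g [hg cg _]; exists g => // x.
by rewrite -hg ?hE// inE; exact: set_valP.
Qed.

(** Real and imaginary parts are extended separately, so the norm of [f] is not controlled away from
    the Cantor set; localization takes care of this later. *)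
Lemma X_extension (k : scalars) (V : normedModType (scalar_field R k))
  (J : {linear V -> C_cantor R k}) (v : V) :
  exists f : X_space J, forall x : cantor_middle_third, X_fun f (cantor_incl x) = J v x.
Proof.
have cv := cspace_continuous (f := J v).
have [x|x|gr cgr grE] := @cantor_real_extension (fun x => re (J v x)) (nrm (J v)).
- by apply: continuous_comp; [exact: cv|exact: re_continuous].
- by apply: le_trans (re_norm_le _) _; exact: cspace_absR_le.
have [x|x|gi cgi giE] := @cantor_real_extension (fun x => im (J v x)) (nrm (J v)).
- by apply: continuous_comp; [exact: cv|exact: im_continuous].
- by apply: le_trans (im_norm_le _) _; exact: cspace_absR_le.
pose h (x : R^o) : (scalar_field R k)^o := of_real k (gr x) + imag_unit * of_real k (gi x).
have ch : continuous h.
  move=> x; apply: cvgD.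
    by apply: (continuous_comp (cgr x)); exact: of_real_continuous.
  apply: (@cvgM (scalar_field R k)); first exact: cvg_cst.
  by apply: (continuous_comp (cgi x)); exact: of_real_continuous.
have [|x|f fh] := @X_spaceP _ _ _ J (fun t => h (set_val t)) v.
- by move=> t; apply: (continuous_comp (@set_val_continuous _ _ t)); exact: ch.
- have <- : set_val x = set_val (cantor_incl x) by [].
  by rewrite /h grE giE -re_im.
exists f => x; rewrite fh.
have <- : set_val x = set_val (cantor_incl x) by [].
by rewrite /h grE giE -re_im.
Qed.

End cantor_extension.

(** * Finite-rank dissipative operators on the dual *)

Section dual_contractions.
Context {R : realType} {k : scalars} {J : {linear ell2 R k -> C_cantor R k}}.
Context (J_isometry : forall x, `|J x| = `|x|).
Local Notation K := (scalar_field R k).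
Local Notation X := (X_space J).
Local Notation I01 := (set_type (`[0, 1]%classic : set R)).
Local Notation Cantor := (@cantor_middle_third R).

Lemma J_nrm x : nrm (J x) = nrm x.
Proof. by rewrite /nrm J_isometry. Qed.

Lemma J_inj v w : (forall x, J v x = J w x) -> v = w.
Proof.
move=> vw; apply/eqP; rewrite -subr_eq0; apply/eqP/nrm_eq0.
rewrite -J_nrm linearB/=; apply/eqP; rewrite eq_le nrm_ge0 andbT.
apply: cspace_nrm_le => // x.
have -> : (J v - J w : C_cantor R k) x = J v x - J w x by [].
by rewrite vw subrr absR0.
Qed.

Lemma restriction_nrm_le (f : X) v :
  (forall x, X_fun f (cantor_incl x) = J v x) -> nrm v <= nrm f.
Proof.
move=> fv; rewrite -J_nrm; apply: cspace_nrm_le; first exact: nrm_ge0.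
by move=> x; rewrite -fv; exact: X_absR_le.
Qed.

(** Since [J] is isometric, the vector representing a restriction is unique, so choosing it is
    linear and norm-decreasing. *)
Lemma coordinate_functional (n : nat) : exists rho : dual X,
  forall f v, (forall x, X_fun f (cantor_incl x) = J v x) -> rho f = ell_fun v n.
Proof.
pose r (f : X) := sval (cid (X_restriction f)).
have rP (f : X) x : X_fun f (cantor_incl x) = J (r f) x by exact: (svalP (cid (X_restriction f))).
have rE f v : (forall x, X_fun f (cantor_incl x) = J v x) -> r f = v.
  by move=> fv; apply: J_inj => x; rewrite -rP fv.
have [e eP] := @ell2_delta R k n.
have e0 : 0 < nrm e.
  rewrite lt_neqAle nrm_ge0 andbT eq_sym; apply/eqP => /nrm_eq0 e0.
  by have := eP n; rewrite e0 eqxx => /eqP; rewrite eq_sym oner_eq0.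
(* The constant comes from [v n *: e] having coordinates dominated by those of [v]; the norm of [e]
   itself is never computed. *)
have [|f|rho rhoE] := @dual_of_bounded R k X (fun f => ell_fun (r f) n) (nrm e)^-1.
- move=> a f g; rewrite (rE (a *: f + g) (a *: r f + r g))// => x.
  by rewrite linearP/= -[LHS]/(a * X_fun f (cantor_incl x) + X_fun g (cantor_incl x)) !rP.
- rewrite mulrC ler_pdivlMr// -nrmZ.
  apply: le_trans (restriction_nrm_le (rP f)); apply: ell2_le => i.
  rewrite ell_funZ eP; case: eqP => [->|_]; first by rewrite mulr1.
  by rewrite mulr0 absR0 absR_ge0.
by exists rho => f v fv; rewrite rhoE (rE _ _ fv).
Qed.

Local Notation d := (dist_to Cantor).

Lemma dist_cantor_continuous : continuous (d : R^o -> R^o).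
Proof. by apply: dist_to_continuous; exists 0; exact: cantor0. Qed.

Lemma ramp_dist_continuous n : continuous (fun t : I01 => ramp n (d (set_val t)) : R^o).
Proof.
apply: (@continuous_set_val_comp R _ (ramp n \o d)) => x.
apply: (@continuous_comp R^o R^o R^o d (ramp n)); first exact: dist_cantor_continuous.
exact: ramp_continuous.
Qed.

Lemma ramp_dist0 n (x : Cantor) : ramp n (d (set_val (cantor_incl x))) = 0.
Proof. by rewrite dist_to_eq0 ?ramp0//; exact: (set_valP x). Qed.

(** Patching [F] with the value 0 away from the Cantor set: the restriction is kept, while the
    region where [G n] is nonzero shrinks to the Cantor set. *)
Lemma localizations (F : X) : exists G : nat -> X, forall n t,
  X_fun (G n) t = X_fun F t - of_real k (ramp n (d (set_val t))) * X_fun F t.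
Proof.
have G n := X_patch F 0 (@ramp_dist_continuous n) (@ramp_dist0 n).
exists (fun n => sval (cid (G n))) => n t; rewrite (svalP (cid (G n))).
by rewrite sub0r mulrN.
Qed.

(* Consecutive differences of the localizations are nonnegative multiples of
   [F] with bounded sums, so every functional is summable along them. *)
Lemma localization_cvg (F : X) (G : nat -> X) (phi : dual X) :
  (forall n t, X_fun (G n) t = X_fun F t - of_real k (ramp n (d (set_val t))) * X_fun F t) ->
  exists l : K^o, (fun n => phi (G n)) @ \oo --> l.
Proof.
move=> GE; pose psi n := G n.+1 - G n.
have [|l lP] := @scalar_normed_series_cvg _ _ (fun n => phi (psi n)) (nrm phi * nrm F).
  move=> n; apply: X_dual_series_le; first exact: nrm_ge0.
  move=> t; set dt := d (set_val t).
  have dt0 : 0 <= dt by exact: dist_to_ge0.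
  have psiE i : absR (X_fun (psi i) t) = (ramp i.+1 dt - ramp i dt) * absR (X_fun F t).
    have -> : X_fun (psi i) t = - of_real k (ramp i.+1 dt - ramp i dt) * X_fun F t.
      rewrite -[LHS]/(X_fun (G i.+1) t - X_fun (G i) t) !GE of_realD of_realN.
      by rewrite -/dt; ring.
    by rewrite mulNr absRN absRM absR_of_real ger0_norm// subr_ge0 ramp_le.
  under eq_bigr do rewrite psiE.
  rewrite -mulr_suml -(big_mkord xpredT (fun i => ramp i.+1 dt - ramp i dt)).
  rewrite telescope_sumr//.
  have /andP[r0 _] := ramp_itv 0 dt0; have /andP[_ r1] := ramp_itv n dt0.
  apply: le_trans (X_absR_le F t); rewrite ler_piMl ?absR_ge0//; lra.
exists (phi (G 0%N) + l).
have -> : (fun n => phi (G n)) = (fun n => phi (G 0%N) + \sum_(i < n) phi (psi i)).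
  apply/funext => n; elim: n => [|n IH]; first by rewrite big_ord0 addr0.
  by rewrite big_ord_recr/= addrA -IH /psi linearB/= addrC subrK.
by apply: cvgD => //; exact: cvg_cst.
Qed.

(* On a neighbourhood of the Cantor set [f - c F] has norm close to [1], and
   elsewhere the localizations vanish. *)
Lemma localization_near_contraction (F f : X) (G : nat -> X) (c : K) (e : R) :
  (forall n t, X_fun (G n) t = X_fun F t - of_real k (ramp n (d (set_val t))) * X_fun F t) ->
  nrm f <= 1 -> 0 < e ->
  (forall x, absR (X_fun (f - c *: F) (cantor_incl x)) <= 1) ->
  \forall n \near \oo, nrm (f - c *: G n) <= 1 + e.
Proof.
move=> GE f1 e0 H1; pose H := f - c *: F.
(* The set where [H] has modulus at least [1 + e] is compact and misses the Cantor set; its least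
   distance to the Cantor set, attained at [t0], serves as [eta]. *)
have [eta eta0 etaP] : exists2 eta : R, 0 < eta &
    forall t : I01, d (set_val t) < eta -> absR (X_fun H t) <= 1 + e.
  pose A : set I01 := [set t | 1 + e <= absR (X_fun H t)].
  have [A0|/set0P A0] := eqVneq A set0.
    exists 1 => // t _; rewrite leNgt; apply/negP => /ltW At.
    by have : A t by []; rewrite A0.
  have cA : compact A.
    apply: (subclosed_compact _ (compact_set_type (@compact_unit R))) => //.
    apply: (@preimage_closed _ _ (fun t : I01 => absR (X_fun H t) : R^o) [set x | 1 + e <= x]).
      move=> t _; apply: continuous_comp; last exact: absR_continuous.
      exact: (@X_continuous _ _ _ _ H).
    exact: closed_ge.
  have cd : {within A, continuous (fun t : I01 => d (set_val t) : R^o)}.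
    apply: continuous_subspaceT.
    by apply: continuous_set_val_comp; exact: dist_cantor_continuous.
  have [t0 At0 t0min] := compact_EVT_min A0 cA cd.
  exists (d (set_val t0)).
    rewrite lt_neqAle dist_to_ge0 andbT eq_sym; apply/eqP => dt0.
    have [del del0 delP] := X_epsilon_delta H t0 e0.
    have [y Cy ty] : exists2 y, Cantor y & `|set_val t0 - y| < del.
      by apply: dist_to_lt; [exists 0; exact: cantor0|rewrite dt0].
    pose y' : Cantor := SigSub (mem_set Cy).
    have far : 1 + e <= absR (X_fun H t0) by rewrite inE in At0.
    have := delP (cantor_incl y'); rewrite distrC => /(_ ty) near.
    have := absRD (X_fun H t0 - X_fun H (cantor_incl y')) (X_fun H (cantor_incl y')).
    rewrite subrK leNgt => /negP; apply.
    by apply: lt_le_trans far; rewrite addrC ler_ltD// H1.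
  move=> t; rewrite ltNge => tt0; rewrite leNgt; apply/negP => /ltW At.
  by move: tt0; rewrite t0min// inE.
have := pow2_archi eta0; apply: filterS => n n1.
apply: X_nrm_le => [|t]; first by rewrite addr_ge0// ltW.
have ft : absR (X_fun f t) <= 1 by exact: le_trans (X_absR_le f t) f1.
set dt := d (set_val t); have dt0 : 0 <= dt by exact: dist_to_ge0.
have /andP[r0 r1] := ramp_itv n dt0.
(* A convex combination of [f], bounded by 1 everywhere, and of [H], which is bounded by [1 + e]
   wherever its weight is nonzero. *)
have -> : X_fun (f - c *: G n) t = of_real k (ramp n dt) * X_fun f t +
    of_real k (1 - ramp n dt) * X_fun H t.
  rewrite -[LHS]/(X_fun f t - c * X_fun (G n) t) GE.
  rewrite -[X_fun H t]/(X_fun f t - c * X_fun F t) of_realD of_realN of_real1 -/dt.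
  by ring.
apply: le_trans (absRD _ _) _; rewrite !absRM !absR_of_real !ger0_norm ?subr_ge0//.
have [tlt|tge] := ltP dt eta.
  have Ht := etaP t tlt.
  have := ler_wpM2l r0 ft; have : (1 - ramp n dt) * absR (X_fun H t) <= (1 - ramp n dt) * (1 + e).
    by rewrite ler_wpM2l// subr_ge0.
  by move=> h1 h2; apply: le_trans (lerD h2 h1) _; have := mulr_ge0 r0 (ltW e0); lra.
have -> : ramp n dt = 1.
  by apply: ramp_eq1; apply: le_trans n1 _; rewrite ler_wpM2l// exprn_ge0.
by rewrite subrr mul0r addr0 mul1r; lra.
Qed.

(** Here [rho n] is the n-th coordinate of the restriction and [lam n phi] is the limit of [phi]
    along the localized extensions of [J (e n)]; thus [lam n] is an element of the bidual, kept as a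
    bounded linear map. *)
Lemma contractive_biorthogonal_system :
  exists (rho : nat -> dual X) (lam : nat -> dual X -> K^o),
  [/\ forall n, linear (lam n),
      forall n, exists C, forall phi, absR (lam n phi) <= C * nrm phi,
      forall n phi, nrm (phi - lam n phi *: rho n) <= nrm phi &
      forall n m, lam n (rho m) = if n == m then 1 else 0].
Proof.
have eP n := svalP (cid (@ell2_delta R k n)).
pose e n : ell2 R k := sval (cid (@ell2_delta R k n)).
have rhoP n := svalP (cid (coordinate_functional n)).
pose rho n : dual X := sval (cid (coordinate_functional n)).
have FP n := svalP (cid (X_extension J (e n))).
pose F n : X := sval (cid (X_extension J (e n))).
have GP n := svalP (cid (localizations (F n))).
pose G n : nat -> X := sval (cid (localizations (F n))).
have lamP n phi := svalP (cid (localization_cvg phi (GP n))).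
pose lam n phi : K^o := sval (cid (localization_cvg phi (GP n))).
have Gcantor n j x : X_fun (G n j) (cantor_incl x) = J (e n) x.
  by rewrite /G GP ramp_dist0 of_real0 mul0r subr0; exact: FP.
exists rho, lam; split.
- move=> n a phi psi; apply: (scalar_cvg_unique (lamP n (a *: phi + psi))).
  have h : (fun j => a * phi (G n j) + psi (G n j) : K^o) @ \oo -->
      (a * lam n phi + lam n psi : K^o).
    by apply: cvgD; [apply: cvgM; [exact: cvg_cst|exact: lamP]|exact: lamP].
  exact: h.
- move=> n; exists (nrm (F n)) => phi; rewrite mulrC.
  apply: (absR_cvg_le (lamP n phi)); apply: nearW => j.
  apply: le_trans (dual_absR_le _ _) _; rewrite ler_wpM2l ?nrm_ge0//.
  apply: X_nrm_le => [|t]; first exact: nrm_ge0.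
  rewrite GP; set r := ramp j _.
  have /andP[r0 r1] : 0 <= r <= 1 by apply: ramp_itv; exact: dist_to_ge0.
  have -> : X_fun (F n) t - of_real k r * X_fun (F n) t =
      of_real k (1 - r) * X_fun (F n) t.
    by rewrite of_realD of_realN of_real1; ring.
  rewrite absRM absR_of_real ger0_norm ?subr_ge0//.
  apply: le_trans (X_absR_le (F n) t); rewrite ler_piMl ?absR_ge0//; lra.
- move=> n phi; apply: dual_nrm_le; first exact: nrm_ge0.
  move=> f f1; set c := rho n f.
  have [v fv] := X_restriction f.
  have cE : c = ell_fun v n by exact: rhoP fv.
  have -> : (phi - lam n phi *: rho n) f = phi f - c * lam n phi.
    by rewrite -[LHS]/(phi f - lam n phi * rho n f) mulrC.
  (* With [c = rho n f], the value of the modified functional at [f] is a limit of values of [phi]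
     itself at vectors of norm almost at most 1. *)
  have lim : (fun j => phi (f - c *: G n j)) @ \oo --> (phi f - c * lam n phi : K^o).
    have -> : (fun j => phi (f - c *: G n j)) = (fun j => phi f - c *: phi (G n j)).
      by apply/funext => j; rewrite linearB linearZ.
    by apply: cvgB; [exact: cvg_cst|apply: cvgZr; exact: lamP].
  rewrite -[leRHS]mulr1; apply/ler_addgt0Pr => eps eps0.
  (* Scaled so that [nrm phi] times this is at most [eps]; the [+ 1] covers [phi = 0]. *)
  have eps'0 : 0 < eps / (nrm phi + 1) by rewrite divr_gt0// ltr_wpDl ?nrm_ge0.
  apply: (absR_cvg_le lim).
  (* On the Cantor set, subtracting [c *: F n] deletes the n-th coordinate of [v], which does not
     increase the l2 norm. *)
  have H1 x : absR (X_fun (f - c *: F n) (cantor_incl x)) <= 1.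
    have -> : X_fun (f - c *: F n) (cantor_incl x) = J (v - c *: e n) x.
      have -> : J (v - c *: e n) = J v - c *: J (e n) by rewrite linearB linearZ.
      by rewrite -[RHS]/(J v x - c * J (e n) x) -fv -FP.
    apply: le_trans (cspace_absR_le _ _) _; rewrite J_nrm.
    apply: le_trans f1; apply: le_trans (restriction_nrm_le fv).
    apply: ell2_le => i; rewrite -[ell_fun (v - _) i]/(ell_fun v i - c * ell_fun (e n) i) eP.
    case: eqP => [->|_]; first by rewrite mulr1 cE subrr absR0 absR_ge0.
    by rewrite mulr0 subr0.
  have := localization_near_contraction (GP n) f1 eps'0 H1; apply: filterS => j fG.
  apply: le_trans (dual_absR_le _ _) _.
  apply: le_trans (ler_wpM2l (nrm_ge0 _) fG) _.
  rewrite mulrDr lerD2l mulrA ler_pdivrMr ?ltr_wpDl ?nrm_ge0//.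
  by rewrite mulrC ler_wpM2l ?lerDl// ltW.
- move=> n m; apply: (scalar_cvg_unique (lamP n (rho m))).
  (* All localizations of [F n] restrict to [J (e n)], so the sequence is constant. *)
  have -> : (fun j => rho m (G n j)) = (fun=> if n == m then 1 else 0).
    by apply/funext => j; rewrite (rhoP m _ (e n)) ?eP 1?eq_sym//; exact: Gcantor.
  exact: cvg_cst.
Qed.

(* [1 + Re (phi (S z)) = Re (phi (z + S z)) <= |z + S z| <= 1] *)
Lemma contraction_dissipative (Z : normedModType K) (S : Z -> Z) :
  (forall z, nrm (z + S z) <= nrm z) -> dissipative S.
Proof.
move=> ctr _ [z [phi [/nrm1P z1 /nrm1P phi1 phiz ->]]].
have := le_trans (re_le _) (dual_absR_le phi (z + S z)).
rewrite linearD/= phiz phi1 mul1r reD -{1}(of_real1 (k := k)) of_realK.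
by have := ctr z; rewrite z1; lra.
Qed.

(** The rank-one operators [phi |-> - lam n phi *: rho n] are dissipative because adding the
    identity gives a contraction. *)
Lemma dual_finite_rank_dissipative :
  exists S : nat -> {linear dual X -> dual X},
    (forall n, [/\ continuous (S n), finite_rank (S n) & dissipative (S n)]) /\
    linearly_independent (fun n => S n : dual X -> dual X).
Proof.
have [rho [lam [lamL lamC lamE lam_rho]]] := contractive_biorthogonal_system.
pose s n (phi : dual X) : dual X := - lam n phi *: rho n.
have sL n : linear (s n).
  by move=> a phi psi; rewrite /s lamL opprD scalerDl -scalerN -scalerA.
pose S n := sval (cid (linear_bundle (sL n))).
have SE n phi : S n phi = - lam n phi *: rho n by exact: (svalP (cid (linear_bundle (sL n)))).
exists S; split=> [n|].
  split.
  - have [C lamnC] := lamC n.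
    have SC phi : nrm (S n phi) <= C * nrm (rho n) * nrm phi.
      by rewrite SE nrmZ absRN mulrAC ler_wpM2r ?nrm_ge0.
    exact: nrm_le_continuous SC.
  - exists 1%N, (fun=> rho n) => phi; exists (fun=> - lam n phi).
    by rewrite big_ord1 SE.
  - by apply: contraction_dissipative => phi; rewrite SE scaleNr.
(* Biorthogonality: evaluating the relation at [rho i] and then applying [lam i] isolates [a i]. *)
move=> n a aS i; have := congr1 (fun T : dual X -> dual X => T (rho i)) aS.
rewrite fct_sumE /=.
have -> : \sum_(j < n) (a j *: (S j : dual X -> dual X)) (rho i) = - a i *: rho i.
  rewrite (bigD1 i)//= big1 ?addr0.
    rewrite -[LHS]/(a i *: S i (rho i)) SE lam_rho eqxx.
    by rewrite scalerA mulrN1.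
  move=> j ji; rewrite -[LHS]/(a j *: S j (rho i)) SE lam_rho.
  by rewrite -(inj_eq val_inj) in ji; rewrite (negbTE ji) oppr0 scale0r scaler0.
move=> /(congr1 (lam i)); have lamZ c phi : lam i (c *: phi) = c * lam i phi.
  have l0 : lam i 0 = 0.
    by have := lamL i (-1) 0 0; rewrite scaler0 addr0 scaleN1r addNr.
  by have := lamL i c phi 0; rewrite addr0 l0 addr0.
have -> : (0 : dual X -> dual X) (rho i) = 0 *: rho i by rewrite scale0r.
by rewrite !lamZ lam_rho eqxx !mulr1 => /eqP; rewrite oppr_eq0 => /eqP.
Qed.

End dual_contractions.

(** * Dissipative operators fix a copy of l1 *)

Section cantor_empty_interior.
Context {R : realType}.
Local Notation I01 := (set_type (`[0, 1]%classic : set R)).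
Local Notation Cantor := (@cantor_middle_third R).

Lemma cantor_stage_sub n : @cantor_stage R n `<=` `[0, 1].
Proof.
elim: n => [//|n IH] x /= []; move=> [y /IH /=]; rewrite !in_itv/= => /andP[y0 y1] <-.
  by apply/andP; split; lra.
by apply/andP; split; lra.
Qed.

(** An interval inside stage [n.+1] cannot cross the removed middle third, so one of [3 * x] and
    [3 * x - 2] maps it into stage [n], tripling its length. *)
Lemma cantor_stage_length n (a b : R) : a <= b ->
  (forall x, a <= x <= b -> cantor_stage n x) -> (b - a) * 3 ^+ n <= 1.
Proof.
elim: n a b => [|n IH] a b ab abn.
  have /abn/= : a <= a <= b by rewrite lexx.
  have /abn/= : a <= b <= b by rewrite lexx andbT.
  by rewrite !in_itv/= expr0 mulr1 => /andP[? ?] /andP[? ?]; lra.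
have side x : a <= x <= b -> (x <= 1 / 3 /\ cantor_stage n (3 * x)) \/
    (2 / 3 <= x /\ cantor_stage n (3 * x - 2)).
  move=> /abn; rewrite cantor_stageS => -[/= h|/= h]; [left|right]; split => //.
    by have := cantor_stage_sub h; rewrite /= in_itv/= => /andP[? ?]; lra.
  by have := cantor_stage_sub h; rewrite /= in_itv/= => /andP[? ?]; lra.
suff : (3 * b - 3 * a) * 3 ^+ n <= 1 by rewrite exprS; lra.
have [b2|b2] := ltP b (2 / 3).
  apply: IH => [|x /andP[xa xb]]; first lra.
  have [|[_]|[? _]] := side (x / 3); first by apply/andP; split; lra.
    by rewrite mulrC divfK.
  by lra.
have a2 : 1 / 3 < a.
  rewrite ltNge; apply/negP => a1.
  (* Otherwise the interval would contain 1/2, which lies in neither outer third. *)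
  by have [|[? _]|[? _]] := side (1 / 2); [apply/andP; split|..]; lra.
have -> : 3 * b - 3 * a = (3 * b - 2) - (3 * a - 2) by ring.
apply: IH => [|x /andP[xa xb]]; first lra.
have [|[? _]|[_]] := side ((x + 2) / 3); first by apply/andP; split; lra.
  by lra.
by rewrite mulrC divfK// addrK.
Qed.

Lemma not_cantor_dense (a b : R) : a < b -> exists2 x, a < x < b & ~ Cantor x.
Proof.
move=> ab; apply: contrapT => nx.
have allC x : a < x < b -> Cantor x.
  by move=> xab; apply: contrapT => nC; apply: nx; exists x.
pose c := (b - a) / 3; have c0 : 0 < c by rewrite divr_gt0// subr_gt0.
(* Halving [c] yields [c * 2 ^+ n >= 2], which strictly contradicts the length bound for the closed
   interval from [a + c] to [b - c], whose length is [c]. *)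
have := @pow2_archi R (c / 2); rewrite divr_gt0// => /(_ isT)[n _ /(_ n (leqnn n)) /=].
move=> n1; have := @cantor_stage_length n (a + c) (b - c).
have -> : b - c - (a + c) = c by rewrite /c; field.
move=> h; have : c * 3 ^+ n <= 1.
  apply: h; first by rewrite /c; lra.
  by move=> x /andP[? ?]; apply: allC => //; apply/andP; split; lra.
have : 2 ^+ n <= 3 ^+ n :> R by rewrite lerXn2r ?nnegrE//; lra.
by move=> /(ler_wpM2l (ltW c0)); lra.
Qed.

Lemma segment_itv (t : I01) : 0 <= set_val t <= 1.
Proof. by have := set_valP t; rewrite /= in_itv. Qed.

Lemma segment_point (x : R) : 0 <= x <= 1 -> exists t : I01, set_val t = x.
Proof.
move=> x01; have xI : `[0, 1]%classic x by rewrite /= in_itv.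
by exists (SigSub (mem_set xI)).
Qed.

(** Moves a starting point slightly off the Cantor set, so that functions can be altered around it
    without changing their restriction. *)
Lemma cantor_gap (p : I01) (r : R) : 0 < r ->
  exists2 t : I01, `|set_val t - set_val p| < r &
    exists2 r', 0 < r' & forall x, `|x - set_val t| < r' -> ~ Cantor x.
Proof.
move=> r0; have /andP[p0 p1] := segment_itv p.
set a := set_val p in p0 p1 *.
have [x] := @not_cantor_dense (Num.max 0 (a - r)) (Num.min 1 (a + r)) ltac:(
  by rewrite gt_max !lt_min; apply/andP; split; apply/andP; split; lra).
rewrite gt_max lt_min => /andP[/andP[x0 xa1] /andP[x1 xa2]] nCx.
have [t tx] := @segment_point x ltac:(by rewrite !ltW).
exists t; rewrite tx; first by rewrite ltr_norml; apply/andP; split; lra.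
have : nbhs (x : R^o) (~` (Cantor : set R^o)).
  by apply: open_nbhs_nbhs; split => //; exact: closed_openC closed_cantor.
move=> /nbhs_ballP[r' /= r'0 r'P]; exists r' => // y yx; apply: r'P.
by rewrite /ball/= distrC.
Qed.

End cantor_empty_interior.

(** * Shrinking bump functions with bounded sums *)

Section bumps.
Context {R : realType}.
Local Notation I01 := (set_type (`[0, 1]%classic : set R)).
Local Notation Cantor := (@cantor_middle_third R).

(* Equal to [1] where [|x - t1| = r / 2 ^+ n.+1]; sums over [n] telescope. *)
Definition bump (t1 r : R) (n : nat) (x : R) : R :=
  2 * (ramp n.+1 (`|x - t1| / r) - ramp n (`|x - t1| / r)).

Lemma bump_continuous t1 r n : continuous (bump t1 r n : R^o -> R^o).
Proof.
have cd : continuous (fun x : R^o => `|x - t1| / r : R^o).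
  move=> x; apply: cvgMl; apply: (@cvg_norm _ R^o).
  by apply: cvgB; [exact: cvg_id|exact: cvg_cst].
have cr m : continuous (fun x : R^o => ramp m (`|x - t1| / r) : R^o).
  by move=> x; apply: (@continuous_comp R^o R^o R^o (fun x : R^o => `|x - t1| / r) (ramp m));
    [exact: cd|exact: ramp_continuous].
move=> x; apply: (@cvgMr _ R^o (nbhs x) _
  (fun x : R^o => ramp n.+1 (`|x - t1| / r) - ramp n (`|x - t1| / r) : R^o)).
by apply: cvgB; exact: cr.
Qed.

Lemma bump_itv t1 r n x : 0 < r -> 0 <= bump t1 r n x <= 1.
Proof.
move=> r0; rewrite /bump; set d := _ / r.
have d0 : 0 <= d by rewrite divr_ge0// ltW.
have h := ramp_le n d0; have /andP[_ h1] := ramp_itv n.+1 d0.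
(* Equivalent to [bump] being at most [ramp n.+1], hence at most 1. *)
have h2 : ramp n.+1 d <= 2 * ramp n d.
  rewrite /ramp; have [_|_] := leP 1 (2 ^+ n * d).
    by rewrite mulr1 ge_min; apply/orP; left; lra.
  by rewrite exprS -mulrA ge_min lexx orbT.
by apply/andP; split; lra.
Qed.

Lemma bump_out t1 r n x : 0 < r -> r <= `|x - t1| -> bump t1 r n x = 0.
Proof.
move=> r0 xr; have d1 : 1 <= `|x - t1| / r by rewrite ler_pdivlMr// mul1r.
have p1 m : 1 <= 2 ^+ m * (`|x - t1| / r).
  by rewrite mulr_ege1 ?exprn_ege1 ?ler1n.
by rewrite /bump !ramp_eq1// subrr mulr0.
Qed.

(** The supports shrink to [t1] while every bump vanishes at [t1] itself, so a fixed point escapes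
    all late bumps. This keeps values prescribed earlier exactly unchanged. *)
Lemma bump_near0 t1 r x : 0 < r -> \forall n \near \oo, bump t1 r n x = 0.
Proof.
move=> r0; have [->|xt] := eqVneq x t1.
  by apply: nearW => n; rewrite /bump subrr normr0 mul0r !ramp0 subrr mulr0.
have d0 : 0 < `|x - t1| / r by rewrite divr_gt0// normr_gt0 subr_eq0.
have := pow2_archi d0; apply: filterS => n n1.
rewrite /bump !ramp_eq1 ?subrr ?mulr0//.
by apply: le_trans n1 _; rewrite ler_wpM2r ?ltW// exprS ltr_pMl ?exprn_gt0 ?ltr1n.
Qed.

Lemma bump_sum_le t1 r n x : 0 < r -> \sum_(i < n) bump t1 r i x <= 2.
Proof.
move=> r0; rewrite /bump; set d := _ / r.
have d0 : 0 <= d by rewrite divr_ge0// ltW.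
rewrite -mulr_sumr -(big_mkord xpredT (fun i => ramp i.+1 d - ramp i d)) telescope_sumr//.
by have /andP[? _] := ramp_itv 0 d0; have /andP[_ ?] := ramp_itv n d0; lra.
Qed.

Lemma bump_peak (t1 : I01) (r : R) n : 0 < r <= 1 ->
  exists2 t : I01, `|set_val t - set_val t1| < r & bump (set_val t1) r n (set_val t) = 1.
Proof.
move=> /andP[r0 r1]; pose h := r / 2 ^+ n.+1.
have p0 : 0 < 2 ^+ n.+1 :> R by rewrite exprn_gt0.
have h0 : 0 < h by rewrite divr_gt0.
have hr : h <= r / 2.
  rewrite /h exprS invfM mulrA ler_piMr ?divr_ge0 ?(ltW r0)//.
  by rewrite invf_le1 ?exprn_gt0// exprn_ege1 ?ler1n.
have peak x : `|x - set_val t1| = h -> bump (set_val t1) r n x = 1.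
  move=> xh; have hE : h / r = (2 ^+ n.+1)^-1.
    by rewrite /h mulrAC mulfV ?gt_eqF// mul1r.
  have e1 : ramp n.+1 (h / r) = 1 by rewrite hE ramp_eq1// mulfV ?gt_eqF.
  have e2 : ramp n (h / r) = 1 / 2.
    rewrite hE /ramp exprS invfM mulrA mulrAC mulfV ?gt_eqF ?exprn_gt0// mul1r.
    by rewrite min_r; lra.
  by rewrite /bump xh e1 e2; lra.
have /andP[t0 t2] := segment_itv t1.
set a := set_val t1 in t0 t2 peak *.
(* As [h <= r / 2 <= 1 / 2], the peak on the side facing the farther endpoint stays in the
   segment. *)
have [a2|a2] := leP a (1 / 2).
  have [|t tE] := @segment_point R (a + h); first by apply/andP; split; lra.
  have xh : `|a + h - a| = h by rewrite addrAC subrr add0r gtr0_norm.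
  by exists t; rewrite tE; [rewrite xh; lra|exact: peak].
have [|t tE] := @segment_point R (a - h); first by apply/andP; split; lra.
have xh : `|a - h - a| = h by rewrite addrAC subrr add0r normrN gtr0_norm.
by exists t; rewrite tE; [rewrite xh; lra|exact: peak].
Qed.

Lemma bounded_series_near_lt (a : nat -> R) (C e : R) : 0 < e ->
  (forall n, 0 <= a n) -> (forall n, \sum_(i < n) a i <= C) ->
  \forall n \near \oo, a n < e.
Proof.
move=> e0 a0 aC; pose s n : R^o := \sum_(i < n) a i.
have cs : cvgn s by exact: nonneg_series_is_cvg a0 aC.
have e20 : 0 < e / 2 by rewrite divr_gt0.
have /(@cvgrPdist_lt _ R^o)/(_ _ e20)[N _ NP] := cs.
exists N => // n /= Nn; have := NP n.+1 (leqW Nn); have := NP n Nn.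
have -> : s n.+1 = s n + a n by rewrite /s big_ord_recr.
rewrite /= !ltr_norml.
by move=> /andP[? ?] /andP[? ?]; lra.
Qed.

Lemma near_all_lt (T : Type) (F : set_system T) (FF : Filter F)
    (A : nat -> T -> Prop) (m : nat) :
  (forall i, (i < m)%N -> \forall x \near F, A i x) ->
  \forall x \near F, forall i, (i < m)%N -> A i x.
Proof.
elim: m => [|m IH] Am; first by apply: filterE.
have := @filterI T F FF _ _ (Am m (leqnn _)) (IH (fun i im => Am i (leqW im))).
apply: filterS => x [Amx Aix] i; rewrite ltnS leq_eqVlt => /orP[/eqP->//|].
exact: Aix.
Qed.

End bumps.

(** * Prescribing values of a function while barely moving its image *)

Section prescribed_values.
Context {R : realType} {k : scalars} {V : normedModType (scalar_field R k)}.
Context {J : {linear V -> C_cantor R k}}.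
Local Notation K := (scalar_field R k).
Local Notation X := (X_space J).
Local Notation I01 := (set_type (`[0, 1]%classic : set R)).
Local Notation Cantor := (@cantor_middle_third R).
Context {T : {linear X -> X}} (cT : continuous T).

(** Exhibits [T f] at a point as a functional of [f], so the summability estimates apply to it. *)
Lemma eval_functional (p : I01) : exists phi : dual X, forall f, phi f = X_fun (T f) p.
Proof.
have [M _ TM] := linear_bounded cT.
have [|f|phi phiE] := @dual_of_bounded R k X (fun f => X_fun (T f) p) M.
- by move=> a f g; rewrite linearP.
- exact: le_trans (X_absR_le _ _) (TM f).
by exists phi.
Qed.

Definition agree_on_cantor (f g : X) :=
  forall x : Cantor, X_fun f (cantor_incl x) = X_fun g (cantor_incl x).

(* The corrections [bump n * (u - F)] are summable under every functional, so
   all but finitely many of them barely change [T F] at the points of [P]. *)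
Lemma prescribe_value (F : X) (u : K) (t1 : I01) (r e : R) (P Q : nat -> I01) (m n : nat) :
  nrm F <= 1 -> absR u = 1 -> 0 < r -> 0 < e ->
  (forall x, `|x - set_val t1| < r -> ~ Cantor x) ->
  exists G : X, [/\ nrm G <= 1, agree_on_cantor G F,
    exists2 t : I01, `|set_val t - set_val t1| < r & X_fun G t = u,
    forall i, (i < n)%N -> X_fun G (Q i) = X_fun F (Q i) &
    forall i, (i < m)%N -> absR (X_fun (T G) (P i) - X_fun (T F) (P i)) < e].
Proof.
(* Radius at most 1 guarantees that the peak of a bump lies in the segment. *)
move=> F1 u1 r0 e0 rC; pose r' := Num.min r 1.
have r'0 : 0 < r' by rewrite lt_min r0 ltr01.
have r'r : r' <= r by rewrite ge_min lexx.
have r'1 : 0 < r' <= 1 by rewrite r'0 ge_min lexx orbT.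
pose b i : I01 -> R^o := fun t => bump (set_val t1) r' i (set_val t).
have b01 i t : 0 <= b i t <= 1 by exact: bump_itv.
have cb i : continuous (b i).
  by apply: (@continuous_set_val_comp _ _ (bump (set_val t1) r' i)); exact: bump_continuous.
have bC i x : b i (cantor_incl x) = 0.
  apply: bump_out => //; rewrite leNgt; apply/negP => xr.
  by apply: (rC _ (lt_le_trans xr r'r)); exact: (set_valP x).
have GP i := svalP (cid (X_patch F u (cb i) (bC i))).
pose G i : X := sval (cid (X_patch F u (cb i) (bC i))).
have ft t : absR (X_fun F t) <= 1 by exact: le_trans (X_absR_le F t) F1.
have summable : forall i, (i < m)%N ->
    \forall j \near \oo, absR (X_fun (T (G j)) (P i) - X_fun (T F) (P i)) < e.
  move=> i _; have [phi phiE] := eval_functional (P i).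
  pose psi j := G j - F.
  suff : \forall j \near \oo, absR (phi (psi j)) < e.
    by apply: filterS => j; rewrite /psi linearB/= !phiE.
  (* The 4 is the product of [|u - F| <= 2] and the bound 2 for sums of bumps. *)
  apply: (@bounded_series_near_lt _ _ (nrm phi * 4)) => // [j|j]; first exact: absR_ge0.
  apply: X_dual_series_le => // t.
  apply: (@le_trans _ _ (\sum_(l < j) 2 * b l t)).
    apply: ler_sum => l _; have /andP[b0 _] := b01 l t.
    have -> : X_fun (psi l) t = of_real k (b l t) * (u - X_fun F t).
      by rewrite -[LHS]/(X_fun (G l) t - X_fun F t) GP addrAC subrr add0r.
    rewrite absRM absR_of_real ger0_norm// mulrC ler_wpM2r//.
    by apply: le_trans (absRD _ _) _; rewrite absRN u1; have := ft t; lra.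
  by rewrite -mulr_sumr; have := bump_sum_le (set_val t1) j (set_val t) r'0; rewrite /b; lra.
have vanish : forall i, (i < n)%N -> \forall j \near \oo, b j (Q i) = 0.
  by move=> i _; exact: bump_near0.
have [j [/= Pj Qj]] : exists j, (forall i, (i < m)%N ->
      absR (X_fun (T (G j)) (P i) - X_fun (T F) (P i)) < e) /\
    (forall i, (i < n)%N -> b j (Q i) = 0).
  have := @filterI _ \oo _ _ _ (near_all_lt _ summable) (near_all_lt _ vanish).
  by move=> [N _ /(_ N (leqnn N)) /= [? ?]]; exists N.
exists (G j); split => //.
- apply: X_nrm_le => // t; rewrite GP; have /andP[b0 b1] := b01 j t.
  (* A convex combination of [F t] and [u], both in the unit disc. *)
  have -> : X_fun F t + of_real k (b j t) * (u - X_fun F t) =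
      of_real k (1 - b j t) * X_fun F t + of_real k (b j t) * u.
    by rewrite of_realD of_realN of_real1; ring.
  apply: le_trans (absRD _ _) _; rewrite !absRM !absR_of_real u1 mulr1.
  rewrite !ger0_norm ?subr_ge0//.
  have := ler_wpM2l (_ : 0 <= 1 - b j t) (ft t); rewrite subr_ge0 => /(_ b1).
  by rewrite mulr1; lra.
- by move=> x; rewrite GP bC of_real0 mul0r addr0.
- have [t tr bt] := bump_peak t1 j r'1; exists t; first exact: lt_le_trans tr r'r.
  by rewrite GP {1}/b bt of_real1 mul1r addrC subrK.
- by move=> i /Qj bi; rewrite GP bi of_real0 mul0r addr0.
Qed.

(** One value is treated at a time: half of [e] is spent on the earlier ones and half on the new
    one, and the points [Q] where earlier values were attained are left fixed. *)
Lemma prescribe_values (F : X) (n : nat) (u : nat -> K) (c : nat -> I01)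
    (r : nat -> R) (P : nat -> I01) (m : nat) (e : R) :
  nrm F <= 1 -> 0 < e ->
  (forall i, (i < n)%N -> [/\ absR (u i) = 1, 0 < r i &
     forall x, `|x - set_val (c i)| < r i -> ~ Cantor x]) ->
  exists G : X, [/\ nrm G <= 1, agree_on_cantor G F,
    forall i, (i < n)%N ->
      exists2 t : I01, `|set_val t - set_val (c i)| < r i & X_fun G t = u i &
    forall i, (i < m)%N -> absR (X_fun (T G) (P i) - X_fun (T F) (P i)) < e].
Proof.
move=> F1; elim: n e => [|n IH] e e0 H.
  by exists F; split => // i _; rewrite subrr absR0.
have e20 : 0 < e / 2 by rewrite divr_gt0.
have [G [G1 GF Gu GP]] := IH _ e20 (fun i im => H i (leqW im)).
have [u1 r0 rC] := H n (leqnn _).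
have [Q QP] : exists Q : nat -> I01, forall i, (i < n)%N ->
    `|set_val (Q i) - set_val (c i)| < r i /\ X_fun G (Q i) = u i.
  have /choice[Q QP] : forall i, exists t : I01, (i < n)%N ->
      `|set_val t - set_val (c i)| < r i /\ X_fun G t = u i.
    move=> i; have [im|_] := boolP (i < n)%N; last by exists (c 0%N).
    by have [t ? ?] := Gu i im; exists t.
  by exists Q.
have [G' [G'1 G'G [t tr tu] G'Q G'P]] := prescribe_value P Q m n G1 u1 r0 e20 rC.
exists G'; split => // [x|i|i im].
- by rewrite G'G GF.
- rewrite ltnS leq_eqVlt => /orP[/eqP->|im]; first by exists t.
  by have [? ?] := QP i im; exists (Q i) => //; rewrite G'Q.
- have := absRD (X_fun (T G') (P i) - X_fun (T G) (P i)) (X_fun (T G) (P i) - X_fun (T F) (P i)).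
  by rewrite addrA subrK; have := GP i im; have := G'P i im; lra.
Qed.

(** Evaluation at [t] multiplied by [u^-1] has norm 1 and takes the value 1 at [F], so it is an
    admissible functional for the numerical range. *)
Lemma dissipative_peak (F : X) (u : K) (t : I01) : dissipative T ->
  nrm F <= 1 -> absR u = 1 -> X_fun F t = u -> re (u^-1 * X_fun (T F) t) <= 0.
Proof.
move=> dT F1 u1 Fu.
have Fn1 : nrm F = 1 by apply/eqP; rewrite eq_le F1 -u1 -Fu X_absR_le.
have u0 : u != 0 by rewrite -absR_gt0 u1.
have [|f|phi phiE] := @dual_of_bounded R k X (fun f => u^-1 * X_fun f t) 1.
- move=> a f g; rewrite -[X_fun (a *: f + g) t]/(a * X_fun f t + X_fun g t).
  by rewrite mulrDr mulrCA.
- by rewrite absRM absRV u1 invr1 ler_wpM2l// X_absR_le.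
have phiF : phi F = 1 by rewrite phiE Fu mulVf.
have phi1 : nrm phi = 1.
  apply/eqP; rewrite eq_le; apply/andP; split.
    apply: dual_nrm_le => // z z1; rewrite phiE absRM absRV u1 invr1 mul1r.
    exact: le_trans (X_absR_le z t) z1.
  by have := dual_absR_le phi F; rewrite phiF absR1 Fn1 mulr1.
apply: dT; exists F, phi; split; [exact/nrm1P|exact/nrm1P|exact: phiF|].
by rewrite phiE.
Qed.

End prescribed_values.

(** * Functions whose images realise every pattern of branches *)

Section independent_functions.
Context {R : realType} {k : scalars} {V : normedModType (scalar_field R k)}.
Context {J : {linear V -> C_cantor R k}}.
Local Notation K := (scalar_field R k).
Local Notation X := (X_space J).
Local Notation I01 := (set_type (`[0, 1]%classic : set R)).
Local Notation Cantor := (@cantor_middle_third R).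
Context {T : {linear X -> X}} (cT : continuous T) (dT : dissipative T).

Lemma positive_value : (exists f, T f <> 0) ->
  exists (g : X) (t : I01) (delta : R),
    [/\ nrm g <= 1, 0 < delta & X_fun (T g) t = of_real k delta].
Proof.
move=> [f Tf0]; have [t Tft] : exists t, X_fun (T f) t <> 0.
  apply: contrapT => h; apply: Tf0; apply: X_ext => t.
  by apply: contrapT => tn; apply: h; exists t.
have z0 : 0 < absR (X_fun (T f) t) by rewrite absR_gt0; apply/eqP.
have n0 : 0 < nrm f + 1 by rewrite ltr_wpDl ?nrm_ge0.
pose z := X_fun (T f) t; pose q := absR z / (nrm f + 1).
(* The factor turns the value at [t] into a positive number and scales the norm below 1; the [+ 1]
   in [q] avoids division by zero. *)
exists ((of_real k q * z^-1) *: f), t, q; split.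
- rewrite nrmZ absRM absR_of_real absRV ger0_norm ?divr_ge0 ?absR_ge0 ?(ltW n0)// /q.
  have -> : absR z / (nrm f + 1) * (absR z)^-1 * nrm f = nrm f / (nrm f + 1).
    by field; rewrite !gt_eqF.
  by rewrite ler_pdivrMr// mul1r lerDl.
- by rewrite /q divr_gt0.
rewrite linearZ/= -[LHS]/(of_real k q * z^-1 * z) mulfVK//.
exact/eqP.
Qed.

Context (g : X) (g1 : nrm g <= 1) (t0 : I01) (r0 delta eps : R).
Context (r00 : 0 < r0) (eps0 : 0 < eps).
Context (t0C : forall x, `|x - set_val t0| < r0 -> ~ Cantor x).
Context (gdelta : forall t : I01, `|set_val t - set_val t0| < r0 ->
  absR (X_fun (T g) t - of_real k delta) < eps).
Context (N : nat) (w : 'I_N -> K) (w1 : forall j, absR (w j) = 1).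

(* [None]: the function equals [g] near [t]; [Some j]: it equals [(w j)^-1]
   at a point close to [t], where dissipativity applies. *)
Definition branch_cond (b : option 'I_N) (F : X) (t : I01) : Prop :=
  if b is Some j then re (w j * X_fun (T F) t) < eps
  else absR (X_fun (T F) t - of_real k delta) < 2 * eps.

Lemma branch_cond_near b F t : branch_cond b F t -> \forall s \near t, branch_cond b F s.
Proof.
case: b => [j|] /= Ft.
  have e0 : 0 < eps - re (w j * X_fun (T F) t) by rewrite subr_gt0.
  have [d d0 dP] := X_epsilon_delta (T F) t e0; apply/segment_nbhsP.
  exists d => // s /dP; have := re_le (w j * (X_fun (T F) s - X_fun (T F) t)).
  by rewrite /branch_cond absRM w1 mul1r absRB mulrBr reB; lra.
have e0 : 0 < 2 * eps - absR (X_fun (T F) t - of_real k delta) by rewrite subr_gt0.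
have [d d0 dP] := X_epsilon_delta (T F) t e0; apply/segment_nbhsP.
exists d => // s /dP; rewrite /branch_cond.
have := absRD (X_fun (T F) s - X_fun (T F) t) (X_fun (T F) t - of_real k delta).
by rewrite addrA subrK (absRB (X_fun (T F) s) (X_fun (T F) t)); lra.
Qed.

(** The analogue of Boolean independence in Rosenthal's criterion, with the common point confined to
    the ball around [t0], where [g] may be altered. *)
Definition independent (Fs : seq X) : Prop :=
  forall b : nat -> option 'I_N, exists2 t : I01, `|set_val t - set_val t0| < r0 &
    forall i, (i < size Fs)%N -> branch_cond (b i) (nth 0 Fs i) t.

(** Each pattern for [Fs] holds on a whole ball. A new [F] is obtained from [g] so that every ball
    contains points suitable for every value of the additional branch. *)
Lemma independent_extend (Fs : seq X) : independent Fs ->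
  exists F : X, [/\ nrm F <= 1, agree_on_cantor F g & independent (rcons Fs F)].
Proof.
(* Patterns are coded as finite functions, since only finitely many values can be prescribed. *)
move=> ind; pose n := size Fs; pose W := {ffun 'I_n -> option 'I_N}.
pose ext (b : W) (i : nat) : option 'I_N := if insub i is Some i' then b i' else None.
have /choice[c cP] : forall b : W, exists t : I01, `|set_val t - set_val t0| < r0 /\
    forall i, (i < n)%N -> branch_cond (ext b i) (nth 0 Fs i) t.
  by move=> b; have [t ? ?] := ind (ext b); exists t.
have /choice[r rP] : forall b : W, exists r : R, [/\ 0 < r,
    forall x, `|x - set_val (c b)| < r -> `|x - set_val t0| < r0 &
    forall t : I01, `|set_val t - set_val (c b)| < r ->
      forall i, (i < n)%N -> branch_cond (ext b i) (nth 0 Fs i) t].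
  move=> b; have [ct cb] := cP b.
  have := @near_all_lt I01 (nbhs (c b)) (nbhs_filter (c b))
    (fun i s => branch_cond (ext b i) (nth 0 Fs i) s) n
    (fun i im => branch_cond_near (cb i im)).
  move=> /segment_nbhsP[d d0 dP].
  exists (Num.min d (r0 - `|set_val (c b) - set_val t0|)); split.
  - by rewrite lt_min d0 subr_gt0.
  - move=> x; rewrite lt_min => /andP[_]; rewrite ltrBrDr; apply: le_lt_trans.
    have -> : x - set_val t0 = (x - set_val (c b)) + (set_val (c b) - set_val t0).
      by rewrite addrA subrK.
    exact: ler_normD.
  - by move=> s; rewrite lt_min => /andP[/dP].
pose I := (W * 'I_N)%type; pose b0 : W := [ffun=> None].
(* Enumerates pairs of a pattern and an index [j]; the defaults serve only past the end of the
   list. *)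
pose e (i : nat) : option I := nth None [seq Some x | x <- enum {: I}] i.
pose ew i : W := if e i is Some x then x.1 else b0.
(* [F] takes each value [(w j)^-1] inside each ball, while [T F] stays [eps]-close to [T g] at all
   centres. Prescribing the inverse puts [w j] itself in the dissipativity inequality. *)
have [F [F1 Fg Fu FP]] := @prescribe_values _ _ _ _ T cT g #|{: I}|
   (fun i => if e i is Some x then (w x.2)^-1 else 1) (fun i => c (ew i)) (fun i => r (ew i))
   (fun i => c (nth b0 (enum {: W}) i)) #|{: W}| eps g1 eps0
   ltac:(by move=> i _; have [? rt ?] := rP (ew i); split => // [|x /rt /t0C//];
     case: (e i) => [x|]; rewrite ?absRV ?w1 ?invr1 ?absR1).
exists F; split => // b.
pose bw : W := [ffun i : 'I_n => b i].
have extE i : (i < n)%N -> ext bw i = b i.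
  by move=> im; rewrite /ext insubT/= ffunE.
have [rb0 rbt rbP] := rP bw.
have last_branch t : `|set_val t - set_val (c bw)| < r bw -> branch_cond (b n) F t ->
    exists2 t : I01, `|set_val t - set_val t0| < r0 &
    forall i, (i < size (rcons Fs F))%N -> branch_cond (b i) (nth 0 (rcons Fs F) i) t.
  move=> tr tb; exists t; first exact: rbt.
  move=> i; rewrite size_rcons ltnS nth_rcons leq_eqVlt => /orP[/eqP->|im].
    by rewrite ltnn eqxx.
  by rewrite im -extE//; apply: rbP.
case bn : (b n) => [j|]; last first.
  apply: (last_branch (c bw)); first by rewrite subrr normr0.
  rewrite bn /branch_cond; have [ct _] := cP bw.
  (* At the centre of the ball the bound [2 * eps] splits into the perturbation of [T g] and its
     distance to [delta]. *)
  have := FP (enum_rank bw) (ltn_ord _); rewrite nth_enum_rank.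
  have := gdelta ct.
  have := absRD (X_fun (T F) (c bw) - X_fun (T g) (c bw)) (X_fun (T g) (c bw) - of_real k delta).
  by rewrite addrA subrK; lra.
pose x : I := (bw, j).
have ex : e (enum_rank x) = Some x.
  by rewrite /e (nth_map x) -?cardE ?ltn_ord// nth_enum_rank.
have [t] := Fu (enum_rank x) (ltn_ord _); rewrite /ew ex /= => tr Ft.
apply: (last_branch t tr); rewrite bn /branch_cond.
have := @dissipative_peak _ _ _ _ T F (w j)^-1 t dT F1 _ Ft.
by rewrite invrK absRV w1 invr1 => /(_ erefl) h; apply: le_lt_trans h _.
Qed.

Lemma independent_sequence : exists F : nat -> X,
  [/\ forall n, nrm (F n) <= 1, forall n, agree_on_cantor (F n) g &
    forall n (b : nat -> option 'I_N), exists t : I01,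
      forall i, (i < n)%N -> branch_cond (b i) (F i) t].
Proof.
have ind0 : independent [::].
  by move=> b; exists t0 => //; rewrite subrr normr0.
(* The state of the recursion carries its independence, which the next extension requires. *)
pose S := {Fs : seq X | independent Fs}.
pose next (s : S) := cid (independent_extend (svalP s)).
have next_ind (s : S) : independent (rcons (sval s) (sval (next s))).
  by have [] := svalP (next s).
pose st := fix st n : S := if n is m.+1 then exist _ _ (next_ind (st m)) else exist _ _ ind0.
pose F n := sval (next (st n)).
have stE n : sval (st n) = mkseq F n.
  by elim: n => [//|n IH]; rewrite mkseqS -IH.
exists F; split.
- by move=> n; have [] := svalP (next (st n)).
- by move=> n; have [] := svalP (next (st n)).
move=> n b; have [t _ tP] := svalP (st n) b; exists t => i im.
by have := tP i; rewrite stE size_mkseq nth_mkseq// => /(_ im).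
Qed.

End independent_functions.

(** * Completeness of l1 and closed ranges *)

Section ell1_lemmas.
Context {R : realType} {k : scalars}.
Local Notation K := (scalar_field R k).

Lemma ell1_coord_le (a : ell1 R k) i : absR (ell_fun a i) <= nrm a.
Proof.
apply: le_trans (ell1_sum_le a i.+1); rewrite big_ord_recr/= lerDr.
by apply: sumr_ge0 => j _; exact: absR_ge0.
Qed.

Lemma ell1_tail (a : ell1 R k) (e : R) : 0 < e ->
  exists n, nrm a - \sum_(i < n) absR (ell_fun a i) < e.
Proof.
move=> e0; apply: contrapT => h.
have : nrm a <= nrm a - e.
  apply: ell1_nrm_le => n; rewrite leNgt; apply/negP => nlt; apply: h; exists n.
  by lra.
by lra.
Qed.

Lemma ell1_complete (alpha : nat -> ell1 R k) (b : nat -> R) :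
  (forall m n, (n <= m)%N -> nrm (alpha m - alpha n) <= b n) ->
  (forall e, 0 < e -> exists n, b n < e) ->
  exists a, forall n, nrm (a - alpha n) <= b n.
Proof.
move=> alphab b0.
have coordB (x y : ell1 R k) i : ell_fun (x - y) i = ell_fun x i - ell_fun y i by [].
have /choice[l lP] : forall i, exists l : K^o, (fun n => ell_fun (alpha n) i) @ \oo --> l.
  move=> i; apply: scalar_cauchy_cvg => e e0.
  have [N bN] := b0 (e / 2) ltac:(by rewrite divr_gt0).
  exists N => m n Nm Nn.
  have h p : (N <= p)%N -> absR (ell_fun (alpha p) i - ell_fun (alpha N) i) < e / 2.
    by move=> Np; apply: le_lt_trans bN; rewrite -coordB (le_trans (ell1_coord_le _ _))// alphab.
  have := absRD (ell_fun (alpha m) i - ell_fun (alpha N) i)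
    (ell_fun (alpha N) i - ell_fun (alpha n) i).
  rewrite addrA subrK (absRB (ell_fun (alpha N) i)); have := h m Nm; have := h n Nn.
  by lra.
have lb n N : \sum_(i < N) absR (l i - ell_fun (alpha n) i) <= b n.
  apply/ler_addgt0Pr => e e0.
  (* An error [e'] in each of [N] coordinates adds up to at most [e]; the successor covers
     [N = 0]. *)
  have [e' e'0 e'N] : exists2 e' : R, 0 < e' & e' * N%:R <= e.
    exists (e / N.+1%:R); first by rewrite divr_gt0.
    by rewrite -mulrA ger_pMr// mulrC ler_pdivrMr// mul1r ler_nat.
  have near_l i : (i < N)%N -> \forall m \near \oo, absR (l i - ell_fun (alpha m) i) < e'.
    by move=> _; exact: (cvg_absRP _ _ _).1 (lP i) _ e'0.
  have [m [nm mP]] : exists m, (n <= m)%N /\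
      forall i, (i < N)%N -> absR (l i - ell_fun (alpha m) i) < e'.
    have [M _ MP] := near_all_lt _ near_l.
    by exists (maxn n M); rewrite leq_maxl; split => //; apply: MP; rewrite /= leq_maxr.
  apply: (@le_trans _ _ (\sum_(i < N) (absR (ell_fun (alpha m - alpha n) i) + e'))).
    apply: ler_sum => i _; have := mP i (ltn_ord i).
    have := absRD (l i - ell_fun (alpha m) i) (ell_fun (alpha m) i - ell_fun (alpha n) i).
    by rewrite addrA subrK coordB; lra.
  rewrite big_split/=; apply: lerD.
    exact: le_trans (ell1_sum_le _ _) (alphab _ _ nm).
  by rewrite sumr_const card_ord -mulr_natr.
(* The bound [lb] places the difference between the coordinatewise limit and [alpha 0] in l1; adding
   [alpha 0] back gives the limit. *)
have [beta betaE] := @ell1_mk _ _ (fun i => l i - ell_fun (alpha 0%N) i) _ (lb 0%N).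
exists (beta + alpha 0%N) => n; apply: ell1_nrm_le => N; apply: le_trans (lb n N).
apply: ler_sum => i _.
have -> : ell_fun (beta + alpha 0%N - alpha n) i =
    ell_fun beta i + ell_fun (alpha 0%N) i - ell_fun (alpha n) i by [].
by rewrite betaE subrK.
Qed.

(** Preimages of a sequence converging to [x] are Cauchy by the lower bound, and completeness of l1
    supplies a preimage of [x]. *)
Lemma bounded_below_closed_range (Z : normedModType K) (U : {linear ell1 R k -> Z}) (C c : R) :
  0 < c -> (forall a, nrm (U a) <= C * nrm a) -> (forall a, c * nrm a <= nrm (U a)) ->
  closed (range U).
Proof.
move=> c0 UC Uc x clx.
have [q [q0 qdec small]] : exists q : nat -> R, [/\ forall n, 0 < q n,
    forall m n, (n <= m)%N -> q m <= q n &
    forall e, 0 < e -> exists n, q n < e].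
  exists (fun n => n.+1%:R^-1); split=> [n|m n nm|e e0]; first by rewrite invr_gt0.
    by rewrite lef_pV2 ?posrE// ler_nat.
  exists (Num.truncn e^-1); rewrite -[ltRHS]invrK ltf_pV2 ?posrE ?invr_gt0//.
  by have /truncn_itv/andP[] : 0 <= e^-1 by rewrite invr_ge0 ltW.
have /choice[alpha alphaP] : forall n, exists a, nrm (x - U a) < q n.
  by move=> n; have [_ [a _ <-] xa] := closure_nrmP clx (q0 n); exists a.
(* For [n <= m] the images [U (alpha m)] and [U (alpha n)] differ by at most [2 * q n], and [c]
   converts this into a bound in l1. *)
have [m n nm|e e0|a aP] := @ell1_complete alpha (fun n => 2 / c * q n).
- rewrite mulrAC ler_pdivlMr// mulrC (le_trans (Uc _))// linearB/=.
  have -> : U (alpha m) - U (alpha n) = (x - U (alpha n)) - (x - U (alpha m)).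
    by rewrite opprB [RHS]addrC addrA subrK.
  apply: le_trans (nrmD _ _) _; rewrite nrmN.
  by have := qdec m n nm; have := alphaP m; have := alphaP n; lra.
- have [n nP] := small (c / 2 * e) ltac:(by rewrite mulr_gt0// divr_gt0).
  by exists n; rewrite -ltr_pdivlMl ?divr_gt0// invf_div.
exists a => //; apply/esym/eqP; rewrite -subr_eq0; apply/eqP/nrm_eq0/eqP.
rewrite eq_le nrm_ge0 andbT; apply/ler_addgt0Pr => e e0; rewrite add0r.
have D0 : 0 < 1 + `|C| * (2 / c).
  by rewrite ltr_pwDl// mulr_ge0// divr_ge0// ltW.
have [n nP] := small (e / (1 + `|C| * (2 / c))) ltac:(by rewrite divr_gt0).
have -> : x - U a = (x - U (alpha n)) - U (a - alpha n).
  by rewrite linearB/= opprB addrA subrK.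
apply: le_trans (nrmD _ _) _; rewrite nrmN.
have h1 : nrm (U (a - alpha n)) <= `|C| * (2 / c * q n).
  apply: le_trans (UC _) _; apply: (@le_trans _ _ (`|C| * nrm (a - alpha n))).
    by rewrite ler_wpM2r ?nrm_ge0 ?ler_norm.
  by rewrite ler_wpM2l.
move: nP; rewrite ltr_pdivlMr// => nP; have := alphaP n.
have : q n * (1 + `|C| * (2 / c)) = q n + `|C| * (2 / c * q n) :> R.
  by rewrite mulrDr mulr1 mulrCA (mulrC (q n)).
by lra.
Qed.

End ell1_lemmas.

(** * Absolutely convergent combinations of the [F n] in X(E) *)

Section synthesis.
Context {R : realType} {k : scalars} {V : normedModType (scalar_field R k)}.
Context {J : {linear V -> C_cantor R k}}.
Local Notation K := (scalar_field R k).
Local Notation X := (X_space J).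
Local Notation I01 := (set_type (`[0, 1]%classic : set R)).
Local Notation Cantor := (@cantor_middle_third R).
Context (F : nat -> X) (F1 : forall n, nrm (F n) <= 1).
Context (g : X) (Fg : forall n, agree_on_cantor (F n) g).

Local Notation partial a n := (\sum_(i < n) ell_fun a i *: F i).

Lemma X_partial (a : ell1 R k) n t :
  X_fun (partial a n) t = \sum_(i < n) ell_fun a i * X_fun (F i) t.
Proof. by rewrite X_fun_sum. Qed.

Lemma absR_F n t : absR (X_fun (F n) t) <= 1.
Proof. exact: le_trans (X_absR_le _ _) (F1 n). Qed.

Lemma partial_cvg (a : ell1 R k) t : exists l : K^o,
  (fun n => X_fun (partial a n) t : K^o) @ \oo --> l.
Proof.
have [n|l] := @scalar_normed_series_cvg _ _ (fun i => ell_fun a i * X_fun (F i) t) (nrm a).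
  apply: le_trans (ell1_sum_le a n); apply: ler_sum => i _.
  by rewrite absRM ler_piMr ?absR_ge0 ?absR_F.
move=> h; exists l.
have -> : (fun n => X_fun (partial a n) t : K^o) =
    (fun n => \sum_(i < n) ell_fun a i * X_fun (F i) t).
  by apply/funext => n; rewrite X_partial.
exact: h.
Qed.

Lemma partial_tail (a : ell1 R k) t (l : K^o) n :
  (fun n => X_fun (partial a n) t : K^o) @ \oo --> l ->
  absR (l - X_fun (partial a n) t) <= nrm a - \sum_(i < n) absR (ell_fun a i).
Proof.
move=> al; apply: (@absR_cvg_le _ _ (fun m => X_fun (partial a m) t - X_fun (partial a n) t)).
  by apply: cvgB => //; exact: cvg_cst.
exists n => // m /= nm; rewrite !X_partial.
rewrite (sum_ordB (fun i => ell_fun a i * X_fun (F i) t) nm).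
rewrite lerBrDr; apply: le_trans (ell1_sum_le a m).
rewrite -lerBrDr (sum_ordB (fun i => absR (ell_fun a i)) nm).
apply: le_trans (absR_sum _ _ _) _; apply: ler_sum => i _.
by rewrite absRM ler_piMr ?absR_ge0 ?absR_F.
Qed.

(** The l1 tails bound the error uniformly in [t], so the limit is continuous. On the Cantor set all
    [F i] equal [g], so the limit there is a scalar multiple of [g] and lies in E. *)
Lemma synthesis_point (a : ell1 R k) : exists f : X, forall t,
  (fun n => X_fun (partial a n) t : K^o) @ \oo --> (X_fun f t : K^o).
Proof.
have /choice[l lP] := partial_cvg a.
have cl : continuous (l : I01 -> K^o).
  move=> t; apply/(cvg_absRP (nbhs_filter t)) => e e0; have e40 : 0 < e / 4 by rewrite divr_gt0.
  have [n nP] := ell1_tail a e40.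
  have [d d0 dP] := X_epsilon_delta (partial a n) t e40.
  apply/segment_nbhsP; exists d => // s /dP.
  have := partial_tail n (lP t); have := partial_tail n (lP s).
  move: (X_fun (partial a n) t) (X_fun (partial a n) s) => x y.
  have := absRD (l t - x) (x - y); have := absRD (l t - y) (y - l s).
  by rewrite !addrA !subrK (absRB y); lra.
have [v gv] := X_restriction g.
have [n|s sP] := @scalar_normed_series_cvg _ _ (ell_fun a) (nrm a); first exact: ell1_sum_le.
have [x|f fl] := @X_spaceP _ _ _ J l (s *: v) cl; last first.
  by exists f => t; rewrite fl; exact: lP.
rewrite linearZ/= -[RHS]/(s * J v x) -gv.
apply: (scalar_cvg_unique (lP (cantor_incl x))).
have -> : (fun n => X_fun (partial a n) (cantor_incl x) : K^o) =
    (fun n => (\sum_(i < n) ell_fun a i) * X_fun g (cantor_incl x)).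
  apply/funext => n; rewrite X_partial mulr_suml; apply: eq_bigr => i _.
  by rewrite Fg.
by apply: cvgM => //; exact: cvg_cst.
Qed.

(** The tail estimate serves twice: [n = 0] makes [U] a contraction, and large [n] carries bounds
    from finite sums over to [U]. *)
Lemma ell1_synthesis : exists U : {linear ell1 R k -> X}, forall a n,
  nrm (U a - partial a n) <= nrm a - \sum_(i < n) absR (ell_fun a i).
Proof.
have /choice[U UP] := synthesis_point.
have UL : linear U.
  move=> c a b; apply: X_ext => t; apply: (scalar_cvg_unique (UP (c *: a + b) t)).
  have -> : (fun n => X_fun (partial (c *: a + b) n) t : K^o) =
      (fun n => c * X_fun (partial a n) t + X_fun (partial b n) t).
    apply/funext => n; rewrite !X_partial mulr_sumr -big_split/=.
    apply: eq_bigr => i _.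
    rewrite -[LHS]/((c * ell_fun a i + ell_fun b i) * X_fun (F i) t).
    by rewrite mulrDl mulrA.
  have h : (fun n => c * X_fun (partial a n) t + X_fun (partial b n) t : K^o) @ \oo -->
      (c * X_fun (U a) t + X_fun (U b) t : K^o).
    by apply: cvgD; [apply: cvgM; [exact: cvg_cst|exact: UP]|exact: UP].
  exact: h.
have [U' U'E] := linear_bundle UL; exists U' => a n.
rewrite U'E; apply: X_nrm_le; first by rewrite subr_ge0 ell1_sum_le.
by move=> t; exact: partial_tail (UP a t).
Qed.

End synthesis.

(** * The lower l1 estimate and the fixed copy of l1 *)

Section independent_lower_bound.
Context {R : realType} {k : scalars}.
Local Notation K := (scalar_field R k).

(* A net of the unit circle turns every [a i] nearly positive by one of
   finitely many rotations, so one rotation serves a fixed share of [a]. *)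
Lemma common_rotation : exists2 N : nat, (0 < N)%N &
  forall n (a : nat -> K), exists theta : K, absR theta = 1 /\
    \sum_(i < n) absR (a i) <=
    N%:R * \sum_(i < n | absR (a i) / 2 <= re (theta * a i)) absR (a i).
Proof.
have [s [s1 sP]] := @unimodular_net R k (1 / 2) ltac:(by rewrite divr_gt0).
have sN : (0 < size s)%N.
  by have [u us _] := sP 1 absR1; case: s us {s1 sP}.
exists (size s) => // n a; apply: contrapT => h.
pose S (j : 'I_(size s)) := \sum_(i < n | absR (a i) / 2 <= re (s`_j * a i)) absR (a i).
have lt_S (j : 'I_(size s)) : (size s)%:R * S j < \sum_(i < n) absR (a i).
  rewrite ltNge; apply/negP => hj; apply: h; exists s`_j; split => //.
  by apply: s1; rewrite mem_nth.
have : \sum_(i < n) absR (a i) <= \sum_(j < size s) S j.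
  rewrite /S (exchange_big_dep xpredT)//=; apply: ler_sum => i _.
  have [ai0|ai0] := eqVneq (absR (a i)) 0.
    by rewrite ai0; apply: sumr_ge0.
  have a0 : a i != 0 by rewrite -absR_gt0 lt_neqAle eq_sym ai0 absR_ge0.
  (* [u] is within 1/2 of the conjugate phase of [a i], so [re (u * a i)] is at least half of the
     modulus. *)
  have [u us] := sP (of_real k (absR (a i)) / a i) ltac:(
    by rewrite absRM absRV absR_of_real ger0_norm ?absR_ge0// mulfV).
  move=> /(ler_wpM2r (absR_ge0 (a i))); rewrite -absRM mulrBl mulfVK// => ua.
  have := re_le (of_real k (absR (a i)) - u * a i); rewrite reB of_realK => ru.
  have ui : (index u s < size s)%N by rewrite index_mem.
  rewrite (bigD1 (Ordinal ui))/=; last by rewrite nth_index//; lra.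
  by rewrite lerDl; apply: sumr_ge0 => j _; exact: absR_ge0.
have : \sum_(j < size s) (size s)%:R * S j < \sum_(j < size s) \sum_(i < n) absR (a i).
  by apply: ltr_sum => //; apply/hasP; exists (Ordinal sN).
rewrite -mulr_sumr [ltRHS]sumr_const card_ord -[ltRHS]mulr_natl ltr_pM2l ?ltr0n//.
by move=> /lt_le_trans h1 /h1; rewrite ltxx.
Qed.

Context {V : normedModType K} {J : {linear V -> C_cantor R k}}.
Local Notation X := (X_space J).
Local Notation I01 := (set_type (`[0, 1]%classic : set R)).

(** After a common rotation, coefficients with large real part are paired with values near [delta];
    the others are paired with a branch where their contribution is almost nonnegative. Independence
    yields a point doing all this at once. *)
Lemma dissipative_ell1_sequence (T : {linear X -> X}) :
  continuous T -> dissipative T -> (exists f, T f <> 0) ->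
  exists (F : nat -> X) (g : X) (c : R), [/\ 0 < c, forall n, nrm (F n) <= 1,
    forall n, agree_on_cantor (F n) g &
    forall n (a : nat -> K),
      c * \sum_(i < n) absR (a i) <= nrm (T (\sum_(i < n) a i *: F i))].
Proof.
move=> cT dT T0; have [g [p [delta [g1 delta0 gp]]]] := positive_value T0.
have [M M0 TM] := linear_bounded cT.
have [N0 N00 rot] := common_rotation.
have N0r : 0 < N0%:R :> R by rewrite ltr0n.
(* The good coefficients contribute at least [delta / (4 * N0) = 4 * eps] times the l1 sum, the
   errors cost [2 * eps] times it, and [2 * eps] remains as the constant. *)
pose eps := delta / (16 * N0%:R).
have eps0 : 0 < eps by rewrite divr_gt0// mulr_gt0.
have epsM0 : 0 < eps / M by rewrite divr_gt0.
(* The values of [T (F i)] are bounded by [M], so this mesh produces an error of at most [eps]. *)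
have [s [s1 sP]] := @unimodular_net R k _ epsM0.
pose w (j : 'I_(size s)) : K := s`_j.
have w1 j : absR (w j) = 1 by apply: s1; rewrite mem_nth.
have [d d0 dP] := X_epsilon_delta (T g) p eps0.
have d20 : 0 < d / 2 by rewrite divr_gt0.
have [t0 t0p [r r0 rC]] := cantor_gap p d20.
(* The ball of radius [r'] about [t0] avoids the Cantor set and lies within distance [d] of [p],
   where [T g] is [eps]-close to [delta]. *)
pose r' := Num.min r (d / 2).
have r'0 : 0 < r' by rewrite lt_min r0 d20.
have [F [F1 Fg FP]] := @independent_sequence _ _ _ _ T cT dT g g1 t0 r' delta eps r'0 eps0
  ltac:(by move=> x; rewrite lt_min => /andP[/rC])
  ltac:(move=> t; rewrite lt_min => /andP[_ td]; rewrite -gp absRB; apply: dP;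
    rewrite -(subrK (set_val t0) (set_val t)) -addrA; apply: le_lt_trans (ler_normD _ _) _; lra)
  (size s) w w1.
exists F, g, (2 * eps); split => //; first by rewrite mulr_gt0.
move=> n a; have [theta [theta1 Stheta]] := rot n a.
pose good i := absR (a i) / 2 <= re (theta * a i).
have /choice[b bP] : forall i, exists b : option 'I_(size s),
    if b is Some j then ~~ good i /\
      absR (of_real k (absR (a i)) * w j + theta * a i) <= eps / M * absR (a i)
    else good i.
  move=> i; have [gi|ngi] := boolP (good i); first by exists None.
  have ai0 : absR (a i) != 0.
    apply: contra ngi => /eqP /absR_eq0 ai0.
    by rewrite /good ai0 mulr0 re0 absR0 mul0r.
  have a0 : 0 < absR (a i) by rewrite lt_neqAle eq_sym ai0 absR_ge0.
  (* The minus sign matters: with [w j] near [q], the term is close to [- absR (a i) * (w j * y i)],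
     whose real part exceeds [- eps * absR (a i)]. *)
  pose q : K := - (theta * a i / of_real k (absR (a i))).
  have q1 : absR q = 1.
    rewrite absRN !absRM theta1 mul1r absRV absR_of_real ger0_norm ?absR_ge0//.
    by rewrite mulfV.
  have [u us qu] := sP q q1.
  have ui : (index u s < size s)%N by rewrite index_mem.
  exists (Some (Ordinal ui)); split => //; rewrite /w /= nth_index//.
  have oa0 : of_real k (absR (a i)) != 0.
    by rewrite -absR_gt0 absR_of_real ger0_norm ?absR_ge0.
  have -> : of_real k (absR (a i)) * u + theta * a i = of_real k (absR (a i)) * (u - q).
    by rewrite mulrBr /q mulrN opprK [_ * (_ / _)]mulrC mulfVK.
  rewrite absRM absR_of_real ger0_norm ?absR_ge0// mulrC absRB.
  by rewrite ler_wpM2r ?absR_ge0.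
have [t tP] := FP n b; pose y i : K := X_fun (T (F i)) t.
have yM i : absR (y i) <= M.
  apply: le_trans (X_absR_le _ _) _; apply: le_trans (TM _) _.
  by rewrite ler_piMr ?(ltW M0).
have eps16 : 16 * N0%:R * eps = delta by rewrite /eps mulrC divfK// gt_eqF// mulr_gt0.
have N01 : 1 <= N0%:R :> R by rewrite ler1n.
have epsd : 16 * eps <= delta by rewrite -eps16 -mulrA ler_pM2l// ler_peMl// ltW.
have term i : (i < n)%N -> (if good i then delta / 4 * absR (a i) else 0) -
    2 * eps * absR (a i) <= re (theta * a i * y i).
  move=> im; have := tP i im; have := bP i; have A0 := absR_ge0 (a i).
  case: (b i) => [j [ngi abw] yw|gi yd].
    rewrite (negbTE ngi) sub0r.
    have -> : theta * a i * y i = (of_real k (absR (a i)) * w j + theta * a i) * y i -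
        of_real k (absR (a i)) * (w j * y i) by ring.
    rewrite reB reMl; set z := _ + theta * a i in abw *.
    have h1 : - (eps * absR (a i)) <= re (z * y i).
      have := re_norm_le (z * y i); rewrite ler_norml => /andP[h _]; apply: le_trans h.
      rewrite lerN2 absRM; apply: le_trans (ler_pM (absR_ge0 _) (absR_ge0 _) abw (yM i)) _.
      by rewrite mulrAC divfK// gt_eqF.
    have h2 : absR (a i) * re (w j * y i) <= absR (a i) * eps.
      by rewrite ler_wpM2l// ltW.
    by lra.
  rewrite gi.
  have -> : theta * a i * y i = of_real k delta * (theta * a i) +
      theta * a i * (y i - of_real k delta) by ring.
  rewrite reD reMl.
  have h1 : - (absR (a i) * (2 * eps)) <= re (theta * a i * (y i - of_real k delta)).
    have := re_norm_le (theta * a i * (y i - of_real k delta)).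
    rewrite ler_norml => /andP[h _]; apply: le_trans h.
    by rewrite lerN2 !absRM theta1 mul1r ler_wpM2l// ltW.
  have h2 : delta * (absR (a i) / 2) <= delta * re (theta * a i) by rewrite ler_wpM2l// ltW.
  have h3 : 0 <= delta * absR (a i) by rewrite mulr_ge0// ltW.
  by lra.
apply: le_trans (X_absR_le _ t).
have TE : X_fun (T (\sum_(i < n) a i *: F i)) t = \sum_(i < n) a i * y i.
  rewrite linear_sum/=; under eq_bigr do rewrite linearZ/=.
  by rewrite X_fun_sum.
have -> : absR (X_fun (T (\sum_(i < n) a i *: F i)) t) = absR (theta * \sum_(i < n) a i * y i).
  by rewrite absRM theta1 mul1r TE.
apply: le_trans (re_le _); rewrite [X in re X]mulr_sumr re_sum.
have : \sum_(i < n) ((if good i then delta / 4 * absR (a i) else 0) - 2 * eps * absR (a i))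
    <= \sum_(i < n) re (theta * (a i * y i)).
  by apply: ler_sum => i _; rewrite mulrA; exact: term.
apply: le_trans; rewrite sumrB -big_mkcond/= -!mulr_sumr lerBrDr.
have eps40 : 0 <= 4 * eps by rewrite mulr_ge0// ltW.
have := ler_wpM2l eps40 Stheta.
set S := \sum_(i < n) _; set G := \sum_(i < n | _) _ => h.
have -> : delta / 4 * G = 4 * eps * (N0%:R * G) by rewrite -eps16; field.
by apply: le_trans h; rewrite -mulrDl; have -> : 2 * eps + 2 * eps = 4 * eps by ring.
Qed.

(** The lower bound for [T] composed with [U] does double duty: boundedness of [T] makes [U] bounded
    below, and contractivity of [U] makes [T] bounded below on its range. *)
Lemma dissipative_fixes_copy_of_ell1 (T : {linear X -> X}) :
  continuous T -> (exists f, T f <> 0) -> dissipative T -> fixes_copy_of_ell1 T.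
Proof.
move=> cT T0 dT; have [F [g [c [c0 F1 Fg Tc]]]] := dissipative_ell1_sequence cT dT T0.
have [U Utail] := ell1_synthesis F1 Fg; have [M M0 TM] := linear_bounded cT.
have U1 a : nrm (U a) <= 1 * nrm a.
  by have := Utail a 0%N; rewrite !big_ord0 !subr0 mul1r.
have TUc a : c * nrm a <= nrm (T (U a)).
  apply/ler_addgt0Pr => e e0.
  have cM0 : 0 < c + M by rewrite addr_gt0.
  (* Truncation costs [c] times the tail in the norm of [a] and [M] times the tail in [T (U a)]. *)
  have [n nP] := @ell1_tail R k a (e / (c + M)) ltac:(by rewrite divr_gt0).
  move: (Utail a n) (Tc n (ell_fun a)) nP; rewrite ltr_pdivlMr//.
  set S := \sum_(i < n) absR _; set P := \sum_(i < n) _ => UP TP nP.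
  have TPU : nrm (T P) <= nrm (T (U a)) + M * nrm (U a - P).
    have -> : T P = T (U a) - T (U a - P) by rewrite linearB/= opprB addrC subrK.
    by apply: le_trans (nrmD _ _) _; rewrite nrmN lerD2l.
  have := ler_wpM2l (ltW M0) UP; lra.
have Uc a : c / M * nrm a <= nrm (U a).
  rewrite mulrAC ler_pdivrMr//; apply: le_trans (TUc a) _.
  by rewrite mulrC.
have cM : 0 < c / M by rewrite divr_gt0.
have cU : continuous U by exact: nrm_le_continuous U1.
have Ysub : submod_closed [in range U].
  split=> [|x f h]; rewrite !inE; first by exists 0 => //; rewrite linear0.
  by move=> [a _ <-] [b _ <-]; exists (x *: a + b) => //; rewrite linearP.
exists (range U), U; split => //.
- exact: bounded_below_closed_range cM U1 Uc.
- have Tsub : submod_closed [in [set: ell1 R k]] by split=> [|x f h]; rewrite !inE.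
  by apply: (bounded_below_iso_onto_image Tsub cU cM) => a _; exact: Uc.
- apply: (bounded_below_iso_onto_image Ysub cT c0) => _ [a _ <-].
  apply: le_trans (TUc a); rewrite ler_wpM2l ?(ltW c0)//.
  by have := U1 a; rewrite mul1r.
Qed.

End independent_lower_bound.

Theorem mainTheorem6 (R : realType) (k : scalars)
    (J : {linear ell2 R k -> C_cantor R k})
    (J_isometry : forall x, `|J x| = `|x|) :
  (forall T : {linear X_space J -> X_space J},
     continuous T -> (exists f, T f <> 0) -> dissipative T ->
     fixes_copy_of_ell1 T) /\
  (exists S : nat -> {linear dual (X_space J) -> dual (X_space J)},
     (forall n, [/\ continuous (S n), finite_rank (S n) & dissipative (S n)]) /\
     linearly_independent (fun n => S n : dual (X_space J) -> dual (X_space J))).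
Proof.
split; first exact: dissipative_fixes_copy_of_ell1.
exact: dual_finite_rank_dissipative J_isometry.
Qed.
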